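(* Let $A$ and $B$ be 0-1 matrices of sizes $p\times q$ and $q\times r$, respectively. Given parameters $\ell\in[p]$ and $k\in[r]$, the matrices can be preprocessed by a deterministic algorithm in $O(pq\ell+pr)$ time if $p\ge r$, or in $O(rqk+pr)$ time if $p\le r$, such that afterwards any query asking for the exact value of a single entry $C_{ij}$ ($i\in[p]$, $j\in[r]$) of the arithmetic matrix product $C=AB$ can be answered in $O(\lambda(A,\ell,\mathrm{row}))$ time if $p\ge r$, or in $O(\lambda(B,k,\mathrm{col}))$ time if $p\le r$.
   Context: For a positive integer $r$, $[r]=\{1,\dots,r\}$. The arithmetic matrix product $C=AB$ has entries $C_{ij}=\sum_{h=1}^q A_{ih}B_{hj}$ (over the integers). The Hamming distance $\mathrm{ham}(a,b)$ between $a,b\in\{0,1\}^q$ is the number of coordinates in which they differ. For a 0-1 $p\times q$ matrix $A$, $\lambda(A,\ell,\mathrm{row})$ is the minimum, over all sets $T$ of $\ell$ points of $\{0,1\}^q$, of $\max_{i\in[p]}\min_{u\in T}\mathrm{ham}(A_{i*},u)$, where $A_{i*}$ is the $i$-th row of $A$. For a 0-1 $q\times r$ matrix $B$, $\lambda(B,k,\mathrm{col})$ is the analogous minimum over sets of $k$ points of $\{0,1\}^q$ of the maximum Hamming distance from a column of $B$ to its closest point in the set. Running times are in the standard RAM model. *)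

(* Defs.v *)
From mathcomp Require Import all_boot.
From mathcomp Require Import matrix.
Set Implicit Arguments.
Unset Strict Implicit.
Unset Printing Implicit Defensive.

Definition bvec (q : nat) := {ffun 'I_q -> bool}.

Definition ham (q : nat) (a b : bvec q) : nat := #|[set h | a h != b h]|.

Definition row_vec (p q : nat) (A : 'M[bool]_(p, q)) (i : 'I_p) : bvec q :=
  [ffun h => A i h].
Definition col_vec (q r : nat) (B : 'M[bool]_(q, r)) (j : 'I_r) : bvec q :=
  [ffun h => B h j].

(* min over u in T of ham x u  (T is nonempty below; default q is an
   upper bound of every Hamming distance in {0,1}^q, hence harmless) *)
Definition dist_to (q : nat) (T : {set bvec q}) (x : bvec q) : nat :=
  \big[minn/q]_(u in T) ham x u.

Definition lambda_row (p q : nat) (A : 'M[bool]_(p, q)) (l : nat) : nat :=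
  \big[minn/q]_(T : {set bvec q} | 0 < #|T| <= l)
     \max_(i < p) dist_to T (row_vec A i).

Definition lambda_col (q r : nat) (B : 'M[bool]_(q, r)) (k : nat) : nat :=
  \big[minn/q]_(T : {set bvec q} | 0 < #|T| <= k)
     \max_(j < r) dist_to T (col_vec B j).

Definition prod_entry (p q r : nat) (A : 'M[bool]_(p, q)) (B : 'M[bool]_(q, r))
  (i : 'I_p) (j : 'I_r) : nat :=
  \sum_(h < q) (A i h : nat) * (B h j : nat).

(* Memory is an infinite array of nat-valued cells, initially 0.
   Every instruction costs one time unit. Words are bounded by W:
   writing a value >= W makes the machine fail (overflow). *)
Inductive instr : Type :=
| Const of nat & nat
| Add   of nat & nat & nat
| Sub   of nat & nat & nat    (* Sub d a b  : M[d] := M[a] - M[b] (monus)*)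
| Mul   of nat & nat & nat
| Div   of nat & nat & nat    (* Div d a b  : M[d] := M[a] / M[b] (x/0=0)*)
| Read  of nat & nat
| Write of nat & nat
| Jz    of nat & nat
| Halt.

Definition program := seq instr.
Definition memory := nat -> nat.

Definition upd (m : memory) (d v : nat) : memory :=
  fun x => if x == d then v else m x.

Definition step (W : nat) (ins : instr) (pc : nat) (m : memory)
  : option (nat * memory) :=
  let wr d v := if v < W then Some (pc.+1, upd m d v) else None in
  match ins with
  | Const d v => wr d v
  | Add d a b => wr d (m a + m b)
  | Sub d a b => wr d (m a - m b)
  | Mul d a b => wr d (m a * m b)
  | Div d a b => wr d (m a %/ m b)
  | Read d a => wr d (m (m a))
  | Write a s => wr (m a) (m s)
  | Jz a t => Some (if m a == 0 then t else pc.+1, m)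
  | Halt => Some (pc, m)
  end.

(* exec W P n pc m = Some m' iff program P, started at pc with memory m,
   reaches a Halt (or falls off the end of P) after executing at most n
   instructions (the final Halt included), without overflow; m' is the
   final memory. *)
Fixpoint exec (W : nat) (P : program) (n : nat) (pc : nat) (m : memory)
  : option memory :=
  match n with
  | 0 => None
  | n'.+1 =>
      match nth Halt P pc with
      | Halt => Some m
      | ins => match step W ins pc m with
               | Some (pc', m') => exec W P n' pc' m'
               | None => None
               end
      end
  end.

(* word bound: words of O(log n) bits, i.e. values < (input size)^c *)
Definition wbound (c p q r : nat) : nat := (p + q + r + 2) ^ c.

Definition entry (m n : nat) (M : 'M[bool]_(m, n)) (i j : nat) : nat :=
  match insub i, insub j with
  | Some i', Some j' => (M i' j' : nat)
  | _, _ => 0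
  end.

(* Input layout for preprocessing:
   cell 0 = p, 1 = q, 2 = r, 3 = l, 4 = k,
   cell 5 + i*q + h = A_{ih}      (0 <= i < p, 0 <= h < q),
   cell 5 + p*q + h*r + j = B_{hj} (0 <= h < q, 0 <= j < r),
   all other cells 0. *)
Definition init_mem (p q r : nat) (A : 'M[bool]_(p, q)) (B : 'M[bool]_(q, r))
  (l k : nat) : memory :=
  fun x =>
    if x == 0 then p else if x == 1 then q else if x == 2 then r
    else if x == 3 then l else if x == 4 then k
    else if x < 5 + p * q then entry A ((x - 5) %/ q) ((x - 5) %% q)
    else if x < 5 + p * q + q * r then
      entry B ((x - 5 - p * q) %/ r) ((x - 5 - p * q) %% r)
    else 0.

(* A query (i, j) (0-indexed) is posed by writing i in cell 0 and j in
   cell 1 of the memory left by preprocessing; the answer is read from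
   cell 0 when the query program halts. *)
Definition query_mem (M : memory) (i j : nat) : memory :=
  upd (upd M 0 i) 1 j.

(* Main.v *)
Require Import Defs.
From mathcomp Require Import all_boot matrix.
From mathcomp Require Import zify.

Set Implicit Arguments.
Unset Strict Implicit.
Unset Printing Implicit Defensive.

(** The rows of A are clustered by Gonzalez' farthest-point heuristic: starting
    from row 0, the next centre is a row farthest from the centres chosen so far.
    If D is the final largest distance, the l centres and a farthest row are l + 1
    rows at pairwise distance at least D.  Two of them share a nearest point in
    any set T of l points, so D <= 2 lambda.  For every centre c the products
    (c B)_j are tabulated, and for every row i the list of the at most D positions
    where it differs from its centre; a query corrects (c B)_j at these positions.
    The case p <= r is the same algorithm on the transposed product.

    The programs are written in a small while language, whose compilation to the
    RAM preserves results and, up to a constant factor, running time. *)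

(** For p >= r, a round of the clustering costs O(pq) for the distances and O(rq) for the products
    of its centre; the inequality absorbs the second cost into the first, and this decides which
    factor gets clustered. The factor 2 between D and lambda goes into the constant, and the
    successor of lambda in the query budget pays for the constant work left when lambda is 0.

    Overflow makes the machine fail, so every step also carries size bounds. With s = p + q + r
    there are three scales: S = s^8 is an address behind the input, V = (s + 2)^9 bounds all values
    that the programs compute, and the word bound W leaves room for the addresses of array entries
    with indices below V. *)

Arguments upd _ _ _ _ /.

(** * The machine and a compiler *)

Definition straight (i : instr) : bool :=
  match i with Jz _ _ | Halt => false | _ => true end.

Fixpoint sexec (W : nat) (s : seq instr) (m : memory) : option memory :=
  if s is i :: s' then
    if step W i 0 m is Some (_, m') then sexec W s' m' else None
  else Some m.

(** Quantifying over the leftover fuel [f] lets segments compose by adding their lengths, whatever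
    the rest of the program does, running out of fuel or overflowing included. *)
Definition reaches (W : nat) (P : program) (k pc : nat) (m : memory)
    (pc' : nat) (m' : memory) : Prop :=
  forall f, exec W P (k + f) pc m = exec W P f pc' m'.

Definition code_at (P : program) (pc : nat) (c : seq instr) : Prop :=
  forall x, x < size c -> nth Halt P (pc + x) = nth Halt c x.

Lemma code_at_cat P pc c1 c2 :
  code_at P pc (c1 ++ c2) -> code_at P pc c1 /\ code_at P (pc + size c1) c2.
Proof.
move=> H; split=> x Hx.
  by rewrite H ?size_cat ?ltn_addr // nth_cat Hx.
rewrite -addnA H ?size_cat ?ltn_add2l // nth_cat ltnNge leq_addr /=.
by rewrite addKn.
Qed.

Lemma code_at_cons P pc i c :
  code_at P pc (i :: c) -> nth Halt P pc = i /\ code_at P pc.+1 c.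
Proof.
move=> H; split; first by have := H 0 isT; rewrite addn0.
by move=> x Hx; rewrite addSnnS H.
Qed.

Lemma reaches_trans W P k1 k2 pc1 m1 pc2 m2 pc3 m3 :
  reaches W P k1 pc1 m1 pc2 m2 -> reaches W P k2 pc2 m2 pc3 m3 ->
  reaches W P (k1 + k2) pc1 m1 pc3 m3.
Proof. by move=> H1 H2 f; rewrite -addnA H1 H2. Qed.

Lemma reaches_jz W P pc m a t :
  nth Halt P pc = Jz a t ->
  reaches W P 1 pc m (if m a == 0 then t else pc.+1) m.
Proof. by move=> H f; rewrite add1n /= H. Qed.

Lemma exec_straight W P i n pc m :
  straight i -> nth Halt P pc = i ->
  exec W P n.+1 pc m =
  if step W i 0 m is Some (_, m') then exec W P n pc.+1 m' else None.
Proof. by move=> + /= ->; case: i => //= *; case: ifP. Qed.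

Lemma sexec_reaches W P s pc m m' :
  all straight s -> code_at P pc s -> sexec W s m = Some m' ->
  reaches W P (size s) pc m (pc + size s) m'.
Proof.
elim: s pc m => [|i s IH] pc m /=; first by move=> _ _ [->] f; rewrite addn0.
case/andP=> Hi His /code_at_cons [Hn Hc].
case E: (step W i 0 m) => [[pc1 m1]|] // Hs f.
rewrite addSn (exec_straight _ _ _ Hi Hn) E -addSnnS.
exact: IH His Hc Hs f.
Qed.

Lemma sexec_cat W s1 s2 m m1 :
  sexec W s1 m = Some m1 -> sexec W (s1 ++ s2) m = sexec W s2 m1.
Proof.
elim: s1 m => [|i s1 IH] m /=; first by case=> ->.
by case: (step W i 0 m) => [[pc m2]|] //; apply: IH.
Qed.

(** The prologue is analysed under the smaller bound [V], where success also bounds every cell, by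
    [sexec_bounded]; the machine runs it under [W]. *)
Lemma sexec_widen V W s m m' :
  V <= W -> sexec V s m = Some m' -> sexec W s m = Some m'.
Proof.
move=> VW; elim: s m => [|i s IH] m //=.
case E: (step V i 0 m) => [[pc m1]|] // Hs.
suff -> : step W i 0 m = Some (pc, m1) by apply: IH.
case: i E => //= [d v|d a b|d a b|d a b|d a b|d a|d a]; case: ifP => // HV [<- <-];
  by rewrite (leq_trans HV VW).
Qed.

Lemma sexec_bounded V s m m' :
  (forall x, m x < V) -> sexec V s m = Some m' -> forall x, m' x < V.
Proof.
elim: s m => [|i s IH] m Hm /=; first by case=> <-.
case E: (step V i 0 m) => [[pc m1]|] //; apply: IH => x.
case: i E => /= [d v|d a b|d a b|d a b|d a b|d a|a b|a t|];
  try (by case=> _ <-);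
  by case: ifP => // HV [_ <-]; rewrite /upd; case: ifP.
Qed.

Lemma exec_le W P n n' pc m m' :
  n <= n' -> exec W P n pc m = Some m' -> exec W P n' pc m = Some m'.
Proof.
elim: n n' pc m => [|n IH] [|n'] pc m //= Hn.
case: (nth Halt P pc) => //= [d v|d a b|d a b|d a b|d a b|d a|d a|a t];
  by case: ifP => // _; apply: IH.
Qed.

(* A register [x] lives in cell [x < NV], cell [NV] holds the address [base] of
   the array area, the cells [NV < d < NR] evaluate expressions, and entry [t]
   of array [a] lives in cell [base + NA * t + a], so that distinct arrays never
   overlap. *)
Definition NV : nat := 28.
Definition NR : nat := 40.
Definition NA : nat := 6.

(** * The while language and its compilation *)

Inductive expr : Type :=
| Cst of nat
| Var of nat
| Raw of expr
| Get of nat & expr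
| EAdd of expr & expr
| EMul of expr & expr
| ESub of expr & expr.

Inductive cmd : Type :=
| Set_ of nat & expr
| Put of nat & expr & expr
| Seq of cmd & cmd
| If of expr & cmd
| While of expr & cmd.

Record state := St {
  vr : nat -> nat;
  ar : nat -> nat -> nat;
  raw : nat -> nat }.

Definition setv (st : state) (x v : nat) : state :=
  St (upd (vr st) x v) (ar st) (raw st).

Definition puta (st : state) (a t v : nat) : state :=
  St (vr st)
     (fun b => if b == a then upd (ar st a) t v else ar st b) (raw st).

Fixpoint eval (st : state) (e : expr) : nat :=
  match e with
  | Cst n => n
  | Var x => vr st x
  | Raw e => raw st (eval st e)
  | Get a e => ar st a (eval st e)
  | EAdd e1 e2 => eval st e1 + eval st e2
  | EMul e1 e2 => eval st e1 * eval st e2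
  | ESub e1 e2 => eval st e1 - eval st e2
  end.

(** Only constants, sums and products can overflow: in a bounded state, lookups and truncated
    subtraction return values below [V]. A [Raw] address is confined to the cells between the
    evaluation cells and the array area, which no command writes. *)
Fixpoint safe (V base : nat) (st : state) (e : expr) : Prop :=
  match e with
  | Cst n => n < V
  | Var x => True
  | Raw e => safe V base st e /\ NR <= eval st e < base
  | Get a e => safe V base st e
  | EAdd e1 e2 =>
    [/\ safe V base st e1, safe V base st e2 & eval st e1 + eval st e2 < V]
  | EMul e1 e2 =>
    [/\ safe V base st e1, safe V base st e2 & eval st e1 * eval st e2 < V]
  | ESub e1 e2 => safe V base st e1 /\ safe V base st e2
  end.

Definition bounded (V : nat) (st : state) : Prop :=
  [/\ forall x, vr st x < V, forall a t, ar st a t < V & forall t, raw st t < V].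

(* The cost counts assignments and evaluated tests; each of them takes boundedly
   many machine instructions. *)
Inductive run (V base : nat) : cmd -> state -> nat -> state -> Prop :=
| RunSet x e st : safe V base st e ->
    run V base (Set_ x e) st 1 (setv st x (eval st e))
| RunPut a e1 e2 st : safe V base st e1 -> safe V base st e2 ->
    run V base (Put a e1 e2) st 1 (puta st a (eval st e1) (eval st e2))
| RunSeq c1 c2 st n1 st1 n2 st2 :
    run V base c1 st n1 st1 -> run V base c2 st1 n2 st2 ->
    run V base (Seq c1 c2) st (n1 + n2) st2
| RunIfT e c st n st1 : safe V base st e -> eval st e != 0 ->
    run V base c st n st1 -> run V base (If e c) st n.+1 st1
| RunIfF e c st : safe V base st e -> eval st e = 0 ->
    run V base (If e c) st 1 st
| RunWhileT e c st n1 st1 n2 st2 : safe V base st e -> eval st e != 0 ->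
    run V base c st n1 st1 -> run V base (While e c) st1 n2 st2 ->
    run V base (While e c) st (n1 + n2).+1 st2
| RunWhileF e c st : safe V base st e -> eval st e = 0 ->
    run V base (While e c) st 1 st.

Definition addr (d a : nat) : seq instr :=
  [:: Const d.+1 NA; Mul d d d.+1; Const d.+1 a; Add d d d.+1; Add d d NV].

(** The evaluation cells form a stack: code compiled at [d] leaves its value in cell [d] and touches
    no evaluation cell below it. A register is copied by adding it to 0, as the machine has no move
    instruction. *)
Fixpoint cexp (d : nat) (e : expr) : seq instr :=
  match e with
  | Cst n => [:: Const d n]
  | Var x => [:: Const d 0; Add d d x]
  | Raw e => cexp d e ++ [:: Read d d]
  | Get a e => cexp d e ++ addr d a ++ [:: Read d d]
  | EAdd e1 e2 => cexp d e1 ++ cexp d.+1 e2 ++ [:: Add d d d.+1]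
  | EMul e1 e2 => cexp d e1 ++ cexp d.+1 e2 ++ [:: Mul d d d.+1]
  | ESub e1 e2 => cexp d e1 ++ cexp d.+1 e2 ++ [:: Defs.Sub d d d.+1]
  end.

Definition T0 : nat := NV.+1.

(** Jump targets are absolute, hence the start address [pc]. An unconditional jump is a [Jz] on a
    cell that has just been set to 0. *)
Fixpoint ccmd (pc : nat) (c : cmd) : seq instr :=
  match c with
  | Set_ x e => cexp T0 e ++ [:: Const T0.+1 0; Add x T0 T0.+1]
  | Put a e1 e2 =>
    cexp T0 e1 ++ addr T0 a ++ cexp T0.+1 e2 ++ [:: Write T0 T0.+1]
  | Seq c1 c2 => let s1 := ccmd pc c1 in s1 ++ ccmd (pc + size s1) c2
  | If e c =>
    let se := cexp T0 e in
    let sc := ccmd (pc + size se).+1 c in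
    se ++ Jz T0 (pc + size se + size sc).+1 :: sc
  | While e c =>
    let se := cexp T0 e in
    let sc := ccmd (pc + size se).+1 c in
    se ++ Jz T0 (pc + size se + size sc).+3 :: sc ++ [:: Const T0 0; Jz T0 pc]
  end.

(** Keeps the evaluation stack below [NR]; [Get] takes one cell more, for the computation of the
    address. *)
Fixpoint wfe (d : nat) (e : expr) : bool :=
  match e with
  | Cst _ => d < NR
  | Var x => (d < NR) && (x < NV)
  | Raw e => (d < NR) && wfe d e
  | Get a e => [&& d.+1 < NR, a < NA & wfe d e]
  | EAdd e1 e2 | EMul e1 e2 | ESub e1 e2 => [&& d < NR, wfe d e1 & wfe d.+1 e2]
  end.

Fixpoint wfc (c : cmd) : bool :=
  match c with
  | Set_ x e => (x < NV) && wfe T0 e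
  | Put a e1 e2 => [&& a < NA, wfe T0 e1 & wfe T0.+1 e2]
  | Seq c1 c2 => wfc c1 && wfc c2
  | If e c | While e c => wfe T0 e && wfc c
  end.

Lemma straight_cexp d e : all straight (cexp d e).
Proof.
elim: e d => //= [e IH|a e IH|e1 IH1 e2 IH2|e1 IH1 e2 IH2|e1 IH1 e2 IH2] d;
  by rewrite !all_cat ?IH ?IH1 ?IH2.
Qed.

Lemma size_ccmd pc c : size (ccmd pc c) = size (ccmd 0 c).
Proof.
have size_ccmd_eq pc1 pc2 : size (ccmd pc1 c) = size (ccmd pc2 c).
  elim: c pc1 pc2 => //= [c1 IH1 c2 IH2|e c IH|e c IH] pc1 pc2.
  - by rewrite !size_cat; congr (_ + _); [apply: IH1 | apply: IH2].
  - by rewrite !size_cat /=; congr (_ + _.+1); apply: IH.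
  - by rewrite !size_cat /= !size_cat; congr (_ + (_ + _).+1); apply: IH.
exact: size_ccmd_eq.
Qed.

Definition represents (base : nat) (st : state) (m : memory) : Prop :=
  [/\ forall x, x < NV -> m x = vr st x, m NV = base,
      forall a t, a < NA -> m (base + NA * t + a) = ar st a t &
      forall t, NR <= t < base -> m t = raw st t].

(** * Correctness and running time of compiled code *)

Section Simulation.

Variables (V W base : nat).
(** [V] bounds the values of the language and [W] the machine words: an entry with index below [V]
    lies below address [base + NA * V]. *)
Hypotheses (NR_base : NR <= base) (NA_V : NA < V) (V_W : base + NA * V <= W).

Lemma eval_lt st e : bounded V st -> safe V base st e -> eval st e < V.
Proof.
case=> Bv Ba Br.
elim: e => //= [e1 IH1 e2 IH2 []//|e1 IH1 e2 IH2 []//|e1 IH1 e2 IH2 [S1 S2]].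
by apply: leq_ltn_trans (IH1 S1); rewrite leq_subr.
Qed.

Lemma run_bounded c st n st' :
  run V base c st n st' -> bounded V st -> bounded V st'.
Proof.
elim=> {c st n st'} //; try by move=> *; auto.
  move=> x e st Se B; have := eval_lt B Se; case: B => Bv Ba Br He.
  by split=> //= y; rewrite /upd; case: ifP.
move=> a e1 e2 st _ Se B; have := eval_lt B Se; case: B => Bv Ba Br He.
by split=> //= b t; case: ifP => // _; rewrite /upd; case: ifP.
Qed.

Definition agree_out (d : nat) (m m' : memory) : Prop :=
  forall x, (x < d) || (NR <= x) -> m' x = m x.

Lemma agree_out_trans d d' m1 m2 m3 :
  d <= d' -> agree_out d m1 m2 -> agree_out d' m2 m3 -> agree_out d m1 m3.
Proof. by move=> dd' H1 H2 x Hx; rewrite H2 ?H1 //; lia. Qed.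

Lemma represents_agree_out d st m m' :
  NV < d -> represents base st m -> agree_out d m m' -> represents base st m'.
Proof.
move=> Hd [Rv Rb Ra Rr] H; split.
- by move=> x Hx; rewrite H ?Rv //; lia.
- by rewrite H //; lia.
- by move=> a t Ha; rewrite H ?Ra //; lia.
- by move=> t Ht; rewrite H ?Rr //; lia.
Qed.

Lemma addr_ok st m d a :
  represents base st m -> NV < d -> d.+1 < NR -> a < NA -> m d < V ->
  exists m', [/\ sexec W (addr d a) m = Some m',
    m' d = base + NA * m d + a & agree_out d m m'].
Proof.
move=> [_ Rb _ _] Hd Hd' Ha Hm.
have NA6 : NA = 6 by [].
have F1 : NA < W by lia.
have F2 : m d * NA < W by rewrite NA6; lia.
have F3 : a < W by lia.
have F4 : m d * NA + a < W by rewrite NA6; lia.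
have F5 : m d * NA + a + base < W by rewrite NA6; lia.
have D1 : (d == d.+1) = false by lia.
have D2 : (d.+1 == d) = false by lia.
have D3 : (NV == d) = false by lia.
have D4 : (NV == d.+1) = false by lia.
rewrite /addr /sexec /step F1 /upd !(eqxx, D1, D2, D3, D4, F2, F3, F4, Rb, F5).
eexists; split; [reflexivity | by rewrite /= eqxx NA6; lia |].
move=> x Hx /=.
have -> : (x == d) = false by lia.
by have -> : (x == d.+1) = false by lia.
Qed.

Lemma cexp_ok st d e m :
  represents base st m -> bounded V st -> safe V base st e -> wfe d e -> NV < d ->
  exists m', [/\ sexec W (cexp d e) m = Some m', m' d = eval st e
    & agree_out d m m'].
Proof.
have V_le_W : V <= W by have : NA = 6 by []; lia.
move=> + B; elim: e d m => [n|x|e IH|a e IH|e1 IH1 e2 IH2|e1 IH1 e2 IH2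
  |e1 IH1 e2 IH2] d m R S wf Hd.
- move: S wf => /= S Hd'; rewrite (leq_trans S V_le_W).
  eexists; split; [reflexivity | by rewrite /upd eqxx |].
  by move=> x Hx; rewrite /upd ifF //; lia.
- move: wf => /= /andP[Hd' Hx].
  have Hv : m x < V by case: (R) => Rv _ _ _; rewrite Rv //; case: B.
  have F1 : 0 < W by lia.
  have F2 : m x < W by lia.
  have D : (x == d) = false by lia.
  rewrite /= /upd F1 !(eqxx, D, add0n, F2).
  eexists; split; [reflexivity | by rewrite /= ?eqxx; case: R => Rv _ _ _; rewrite Rv|].
  by move=> y Hy; rewrite !ifF //; lia.
- have Hlt := eval_lt B S.
  move: S wf => /= [S Hr] /andP[Hd' wf].
  have [m1 [E1 V1 A1]] := IH d m R S wf Hd.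
  rewrite (sexec_cat _ E1) /= V1.
  have [_ _ _ Rr] := represents_agree_out Hd R A1.
  move: Hlt => /= Hlt; rewrite Rr // (leq_trans Hlt V_le_W).
  eexists; split; [reflexivity | by rewrite /upd eqxx |].
  by apply: (agree_out_trans (leqnn d) A1) => x Hx; rewrite /upd ifF //; lia.
- have Hlt := eval_lt B S.
  move: S wf => /= S /and3P[Hd' Ha wf].
  have [m1 [E1 V1 A1]] := IH d m R S wf Hd.
  rewrite (sexec_cat _ E1).
  have R1 := represents_agree_out Hd R A1.
  have Hm1 : m1 d < V by rewrite V1; apply: eval_lt.
  have [m2 [E2 V2 A2]] := addr_ok R1 Hd Hd' Ha Hm1.
  rewrite (sexec_cat _ E2) /= V2.
  have [_ _ Ra _] := represents_agree_out Hd R1 A2.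
  move: Hlt => /= Hlt; rewrite Ra // V1 (leq_trans Hlt V_le_W).
  eexists; split; [reflexivity | by rewrite /upd eqxx |].
  apply: (agree_out_trans (leqnn d) A1); apply: (agree_out_trans (leqnn d) A2).
  by move=> x Hx; rewrite /upd ifF //; lia.
all: have Hlt := eval_lt B S; have Hlt' := leq_trans Hlt V_le_W.
all: have [S1 S2] : safe V base st e1 /\ safe V base st e2 by case: (S).
all: move: wf => /= /and3P[Hd' wf1 wf2].
all: have [m1 [E1 V1 A1]] := IH1 d m R S1 wf1 Hd.
all: have R1 := represents_agree_out Hd R A1.
all: have [m2 [E2 V2 A2]] := IH2 d.+1 m1 R1 S2 wf2 (ltnW Hd).
all: rewrite (sexec_cat _ E1) (sexec_cat _ E2) /= V2 A2 ?V1; last by lia.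
all: move: Hlt' => /= ->.
all: eexists; split; [reflexivity | by rewrite /upd eqxx |].
all: apply: (agree_out_trans (leqnn d) A1).
all: apply: (agree_out_trans (leqnn d) (m2 := m2)); first by
  move=> x Hx; rewrite A2 //; lia.
all: by move=> x Hx; rewrite /upd ifF //; lia.
Qed.

Lemma cexp_reaches P pc st e m :
  represents base st m -> bounded V st -> safe V base st e -> wfe T0 e ->
  code_at P pc (cexp T0 e) ->
  exists m', [/\ reaches W P (size (cexp T0 e)) pc m (pc + size (cexp T0 e)) m',
    m' T0 = eval st e & represents base st m'].
Proof.
move=> R B S wf Hc; have [m' [E V1 A]] := cexp_ok R B S wf (ltnSn NV).
exists m'; split=> //; last exact: represents_agree_out R A.
by apply: sexec_reaches E => //; apply: straight_cexp.
Qed.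

(** One unit of cost pays for a straight piece of code, which is at most as long as the whole code;
    a loop round spends its own unit on the test, the conditional exit and the jump back. Hence the
    code size works as the constant factor throughout the induction. *)
Lemma run_sim P c st n st' :
  run V base c st n st' ->
  forall pc m, wfc c -> code_at P pc (ccmd pc c) -> bounded V st ->
  represents base st m ->
  exists k m', [/\ k <= size (ccmd 0 c) * n, represents base st' m' &
    reaches W P k pc m (pc + size (ccmd 0 c)) m'].
Proof.
have V_le_W : V <= W by have : NA = 6 by []; lia.
have W_gt0 : 0 < W by lia.
elim=> {c st n st'}.
- move=> x e st S pc m /= /andP[Hx wf] Hc B R.
  have [m1 [E1 V1 A1]] := cexp_ok R B S wf (ltnSn NV).
  have R1 := represents_agree_out (ltnSn NV) R A1.
  exists (size (ccmd 0 (Set_ x e))), (upd (upd m1 T0.+1 0) x (eval st e)).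
  split; first by rewrite muln1.
    have {}B := eval_lt B S.
    case: R1 => Rv Rb Ra Rr; split.
    + move=> y Hy /=; rewrite /upd; case: ifP => // _.
      by rewrite ifF ?Rv //; move: Hy; rewrite /T0; lia.
    + by rewrite /upd !ifF ?Rb //; rewrite /T0; lia.
    + have : NV = 28 by []. have : NR = 40 by [].
      by move=> ? ? a t Ha; rewrite /upd !ifF ?Ra //; rewrite /T0; lia.
    + have : NV = 28 by []. have : NR = 40 by [].
      by move=> ? ? t Ht; rewrite /upd !ifF ?Rr //; rewrite /T0; lia.
  apply: sexec_reaches => //.
    by rewrite /= all_cat straight_cexp.
  rewrite /= (sexec_cat _ E1) /= W_gt0 /=.
  by rewrite /upd /= V1 addn0 (leq_trans (eval_lt B S) V_le_W).
- move=> a e1 e2 st S1 S2 pc m /= /and3P[Ha wf1 wf2] Hc B R.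
  have [m1 [E1 V1 A1]] := cexp_ok R B S1 wf1 (ltnSn NV).
  have R1 := represents_agree_out (ltnSn NV) R A1.
  have Hm1 : m1 T0 < V by rewrite V1 (eval_lt B S1).
  have [m2 [E2 V2 A2]] := addr_ok R1 (ltnSn NV) isT Ha Hm1.
  have R2 := represents_agree_out (ltnSn NV) R1 A2.
  have [m3 [E3 V3 A3]] := cexp_ok R2 B S2 wf2 (ltnW (ltnSn T0)).
  have R3 := represents_agree_out (ltnW (ltnSn T0)) R2 A3.
  exists (size (ccmd 0 (Put a e1 e2))),
    (upd m3 (base + NA * eval st e1 + a) (eval st e2)).
  split; first by rewrite muln1.
    case: R3 => Rv Rb Ra Rr.
    have NV28 : NV = 28 by []. have NR40 : NR = 40 by []. have NA6 : NA = 6 by [].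
    split.
    + by move=> y Hy; rewrite /upd ifF ?Rv //; lia.
    + by rewrite /upd ifF ?Rb //; lia.
    + move=> b t Hb /=; rewrite /upd.
      have -> : (base + NA * t + b == base + NA * eval st e1 + a) =
                (b == a) && (t == eval st e1) by lia.
      by case: eqP => //= [->|_]; [case: ifP => // _ | ]; rewrite Ra.
    + by move=> t Ht /=; rewrite /upd ifF ?Rr //; lia.
  apply: sexec_reaches => //.
    by rewrite !all_cat !straight_cexp.
  rewrite /= (sexec_cat _ E1) (sexec_cat _ E2) (sexec_cat _ E3) /=.
  rewrite V3 (leq_trans (eval_lt B S2) V_le_W).
  by rewrite (A3 T0) // V2 V1.
- move=> c1 c2 st n1 st1 n2 st2 H1 IH1 H2 IH2 pc m /= /andP[wf1 wf2].
  move/code_at_cat => [Hc1 Hc2] B R.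
  have [k1 [m1 [K1 R1 G1]]] := IH1 _ _ wf1 Hc1 B R.
  rewrite size_ccmd in Hc2.
  have [k2 [m2 [K2 R2 G2]]] := IH2 _ _ wf2 Hc2 (run_bounded H1 B) R1.
  exists (k1 + k2), m2; split=> //; rewrite add0n size_cat (size_ccmd _ c2).
    by nia.
  by rewrite addnA; apply: reaches_trans G1 G2.
- move=> e c st n st1 S Ne H IH pc m /= /andP[wf wf1].
  move/code_at_cat => [Hc1 /code_at_cons [Hj Hc2]] B R.
  have [m1 [G1 V1 R1]] := cexp_reaches R B S wf Hc1.
  have [k2 [m2 [K2 R2 G2]]] := IH _ _ wf1 Hc2 B R1.
  have G3 := reaches_jz W m1 Hj; rewrite V1 (negPf Ne) in G3.
  have G := reaches_trans (reaches_trans G1 G3) G2.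
  rewrite !size_cat /= (size_ccmd _ c).
  exists (size (cexp T0 e) + 1 + k2), m2; split=> //; first by nia.
  by move=> f; rewrite G; congr (exec _ _ _ _ _); lia.
- move=> e c st S Ne pc m /= /andP[wf wf1].
  move/code_at_cat => [Hc1 /code_at_cons [Hj Hc2]] B R.
  have [m1 [G1 V1 R1]] := cexp_reaches R B S wf Hc1.
  have G3 := reaches_jz W m1 Hj; rewrite V1 Ne eqxx in G3.
  have G := reaches_trans G1 G3.
  rewrite !size_cat /= (size_ccmd _ c).
  exists (size (cexp T0 e) + 1), m1; split=> //; first by nia.
  by move=> f; rewrite G; congr (exec _ _ _ _ _); rewrite size_ccmd; lia.
- move=> e c st n1 st1 n2 st2 S Ne H1 IH1 H2 IH2 pc m wfW HcW B R.
  have [wf wf1] : wfe T0 e /\ wfc c by apply/andP.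
  have [Hc1 /code_at_cons [Hj /code_at_cat [Hc2 Hc3]]] := code_at_cat HcW.
  have [m1 [G1 V1 R1]] := cexp_reaches R B S wf Hc1.
  have [k2 [m2 [K2 R2 G2]]] := IH1 _ _ wf1 Hc2 B R1.
  have G3 := reaches_jz W m1 Hj; rewrite V1 (negPf Ne) in G3.
  have G := reaches_trans (reaches_trans G1 G3) G2.
  rewrite size_ccmd in Hc3.
  have [_ /code_at_cons [Hj' _]] := code_at_cons Hc3.
  have [Hk _] := code_at_cons Hc3.
  have G4 : reaches W P 1 ((pc + size (cexp T0 e)).+1 + size (ccmd 0 c)) m2
      ((pc + size (cexp T0 e)).+1 + size (ccmd 0 c)).+1 (upd m2 T0 0).
    by move=> f; rewrite add1n /= Hk W_gt0.
  have G5 := reaches_jz W (upd m2 T0 0) Hj'; rewrite {1}/upd eqxx /= in G5.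
  (* Clearing [T0] for the jump back is harmless: no part of the state lives in an evaluation
     cell. *)
  have R3 : represents base st1 (upd m2 T0 0).
    apply: (@represents_agree_out T0) R2 _ => //.
    move=> x Hx; rewrite /upd ifF //; move: Hx.
      by have: T0 = 29 by []; have: NR = 40 by []; lia.
  have Hsz : size (ccmd 0 (While e c)) = size (cexp T0 e) + size (ccmd 0 c) + 3.
    by rewrite /= !size_cat /= !size_cat (size_ccmd _ c) /=; lia.
  have [k3 [m3 [K3 R4 G6]]] := IH2 _ _ wfW HcW (run_bounded H1 B) R3.
  have {G3 G4 G5 G6}G := reaches_trans (reaches_trans (reaches_trans G G4) G5) G6.
  exists (size (cexp T0 e) + 1 + k2 + 1 + 1 + k3), m3; split=> //.
  by move: K3; rewrite Hsz => K3; nia.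
- move=> e c st S Ne pc m /= /andP[wf wf1].
  move/code_at_cat => [Hc1 /code_at_cons [Hj Hc2]] B R.
  have [m1 [G1 V1 R1]] := cexp_reaches R B S wf Hc1.
  have G3 := reaches_jz W m1 Hj; rewrite V1 Ne eqxx in G3.
  have G := reaches_trans G1 G3.
  rewrite !size_cat /= !size_cat (size_ccmd _ c) /=.
  exists (size (cexp T0 e) + 1), m1; split=> //; first by nia.
  by move=> f; rewrite G; congr (exec _ _ _ _ _); rewrite size_ccmd; lia.
Qed.

End Simulation.
(** * Program logic *)

Definition For (i n : nat) (c : cmd) : cmd :=
  Seq (Set_ i (Cst 0))
      (While (ESub (Var n) (Var i)) (Seq c (Set_ i (EAdd (Var i) (Cst 1))))).

(** A syntactic footprint: [run_agree] turns it into a frame condition, so that specifications speak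
    only of what changes. *)
Fixpoint mods (c : cmd) : seq nat :=
  match c with
  | Set_ x _ => [:: x]
  | Put _ _ _ => [::]
  | Seq c1 c2 => mods c1 ++ mods c2
  | If _ c | While _ c => mods c
  end.

Fixpoint amods (c : cmd) : seq nat :=
  match c with
  | Set_ _ _ => [::]
  | Put a _ _ => [:: a]
  | Seq c1 c2 => amods c1 ++ amods c2
  | If _ c | While _ c => amods c
  end.

Definition agree (xs bs : seq nat) (st st' : state) : Prop :=
  [/\ forall x, x \notin xs -> vr st' x = vr st x,
      forall b, b \notin bs -> ar st' b = ar st b & raw st' = raw st].

Lemma agree_trans xs bs st1 st2 st3 :
  agree xs bs st1 st2 -> agree xs bs st2 st3 -> agree xs bs st1 st3.
Proof.
move=> [v1 a1 r1] [v2 a2 r2]; split=> [x Hx|c Hc|]; last by rewrite r2.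
  by rewrite v2 ?v1.
by rewrite a2 ?a1.
Qed.

Lemma agree_sub xs bs xs' bs' st st' :
  {subset xs <= xs'} -> {subset bs <= bs'} ->
  agree xs bs st st' -> agree xs' bs' st st'.
Proof.
move=> Sx Sb [v a r]; split=> // [x Hx|c Hc]; [apply: v | apply: a].
  by apply: contra Hx; apply: Sx.
by apply: contra Hc; apply: Sb.
Qed.

Lemma agree_setv x xs bs st v : agree (x :: xs) bs st (setv st x v).
Proof.
by split=> //= y; rewrite inE negb_or /upd => /andP[/negPf ->].
Qed.

Section Hoare.

Variables (V base : nat).

Lemma run_agree c st n st' :
  run V base c st n st' -> agree (mods c) (amods c) st st'.
Proof.
elim=> {c st n st'} //=.
- by move=> x e st _; apply: agree_setv.
- move=> a e1 e2 st _ _; split=> //= c.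
  by rewrite inE => /negPf ->.
- move=> c1 c2 st n1 st1 n2 st2 _ A1 _ A2; apply: (agree_trans (st2 := st1)).
    by apply: agree_sub A1 => x Hx; rewrite mem_cat Hx.
  by apply: agree_sub A2 => x Hx; rewrite mem_cat Hx orbT.
- by move=> e c st n1 st1 n2 st2 _ _ _ A1 _ A2; apply: agree_trans A1 A2.
Qed.

Definition ok (c : cmd) (st : state) (n : nat) (Q : state -> Prop) : Prop :=
  exists k st', [/\ k <= n, run V base c st k st' & Q st'].

Lemma ok_weaken c st n n' (Q Q' : state -> Prop) :
  ok c st n Q -> n <= n' ->
  (forall st', agree (mods c) (amods c) st st' -> Q st' -> Q' st') ->
  ok c st n' Q'.
Proof.
move=> [k [st' [Hk R HQ]]] Hn H; exists k, st'; split=> //.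
  exact: leq_trans Hk Hn.
exact: H (run_agree R) HQ.
Qed.

Lemma ok_seq c1 c2 st n1 n2 (Q : state -> Prop) :
  ok c1 st n1 (fun st1 => ok c2 st1 n2 Q) -> ok (Seq c1 c2) st (n1 + n2) Q.
Proof.
move=> [k1 [st1 [H1 R1 [k2 [st2 [H2 R2 HQ]]]]]]; exists (k1 + k2), st2.
by split=> //; [apply: leq_add | apply: RunSeq R1 R2].
Qed.

Lemma ok_set x e st n (Q : state -> Prop) :
  safe V base st e -> Q (setv st x (eval st e)) -> ok (Set_ x e) st n.+1 Q.
Proof. by move=> S HQ; exists 1; eexists; split; [|apply: RunSet|]. Qed.

Lemma ok_put a e1 e2 st n (Q : state -> Prop) :
  safe V base st e1 -> safe V base st e2 ->
  Q (puta st a (eval st e1) (eval st e2)) -> ok (Put a e1 e2) st n.+1 Q.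
Proof. by move=> S1 S2 HQ; exists 1; eexists; split; [|apply: RunPut|]. Qed.

Lemma ok_set_seq x e c st n (Q : state -> Prop) :
  safe V base st e -> ok c (setv st x (eval st e)) n Q ->
  ok (Seq (Set_ x e) c) st n.+1 Q.
Proof. by move=> S H; apply: (@ok_seq _ _ _ 1 n); apply: ok_set. Qed.

Lemma ok_put_seq a e1 e2 c st n (Q : state -> Prop) :
  safe V base st e1 -> safe V base st e2 ->
  ok c (puta st a (eval st e1) (eval st e2)) n Q ->
  ok (Seq (Put a e1 e2) c) st n.+1 Q.
Proof. by move=> S1 S2 H; apply: (@ok_seq _ _ _ 1 n); apply: ok_put. Qed.

Lemma ok_if e c st n (Q : state -> Prop) :
  safe V base st e -> (0 < eval st e -> ok c st n Q) ->
  (eval st e = 0 -> Q st) -> ok (If e c) st n.+1 Q.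
Proof.
move=> S H1 H0; have [E|/H1 [k [st' [Hk R HQ]]]] := posnP (eval st e).
  by exists 1, st; split=> //; [apply: RunIfF | apply: H0].
case: (posnP (eval st e)) => E.
  by exists 1, st; split=> //; [apply: RunIfF | apply: H0].
by exists k.+1, st'; split=> //; apply: RunIfT => //; rewrite -lt0n.
Qed.

(** Each round adds 2 to the body for the test and the increment; the final 2 is the initialisation
    and the failing test. The body may assume agreement with the state before the loop, so
    invariants need not repeat what the loop never writes. *)
Lemma ok_for i n c st N K (I : nat -> state -> Prop) :
  i \notin mods c -> n \notin i :: mods c -> vr st n = N -> N < V ->
  I 0 (setv st i 0) ->
  (forall x st', x < N -> agree (i :: mods c) (amods c) st st' ->
     vr st' i = x -> I x st' ->
     ok c st' K (fun st'' => I x.+1 (setv st'' i x.+1))) ->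
  ok (For i n c) st (N * (K + 2) + 2)
    (fun st' => I N st' /\ agree (i :: mods c) (amods c) st st').
Proof.
move=> Hi Hn EN N_V I0 IS.
rewrite addnS; apply: ok_set_seq => /=; first by lia.
set Q := fun st' : state => _.
have En st' : agree (i :: mods c) (amods c) st st' -> vr st' n = N.
  by case=> H _ _; rewrite H.
suff loop y x st1 : x + y = N -> agree (i :: mods c) (amods c) st st1 ->
    vr st1 i = x -> I x st1 ->
    ok (While (ESub (Var n) (Var i)) (Seq c (Set_ i (EAdd (Var i) (Cst 1)))))
       st1 (y * (K + 2) + 1) Q.
  apply: (loop N 0) => //; first exact: agree_setv.
  by rewrite /= /upd eqxx.
elim: y x st1 => [|y IH] x st1.
  rewrite addn0 => -> A Ei Ix; exists 1, st1; split=> //.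
  by apply: RunWhileF => //=; rewrite Ei (En _ A) subnn.
move=> Exy A Ei Ix.
have xN : x < N by lia.
have [k [st2 [Hk R2 I2]]] := IS x st1 xN A Ei Ix.
have A12 := run_agree R2.
have Ei2 : vr st2 i = x by case: A12 => H _ _; rewrite H.
have A2 : agree (i :: mods c) (amods c) st (setv st2 i x.+1).
  apply: agree_trans A _; apply: agree_trans (agree_setv _ _ _ _ _).
  by apply: agree_sub A12 => // z Hz; rewrite inE Hz orbT.
have Ex1 : vr (setv st2 i x.+1) i = x.+1 by rewrite /= /upd eqxx.
have Exy' : x.+1 + y = N by lia.
have [k3 [st3 [Hk3 R3 Q3]]] := IH _ _ Exy' A2 Ex1 I2.
exists (k + 1 + k3).+1, st3; split=> //; first by lia.
apply: RunWhileT R3 => //=; first by rewrite Ei (En _ A) -lt0n subn_gt0.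
apply: RunSeq R2 _.
have <- : eval st2 (EAdd (Var i) (Cst 1)) = x.+1 by rewrite /= Ei2 addn1.
by apply: RunSet; rewrite /= Ei2; split=> //; lia.
Qed.

End Hoare.
(** * Clustering, difference lists and queries *)

(** The numbering starts at 6 because cells 0 to 4 carry the input parameters, and cells 0 and 1
    later the query. *)
Notation v_p := 6 (only parsing).
Notation v_q := 7 (only parsing).
Notation v_r := 8 (only parsing).
Notation v_l := 9 (only parsing).
Notation v_a0 := 10 (only parsing).
Notation v_ai := 11 (only parsing).
Notation v_ah := 12 (only parsing).
Notation v_b0 := 13 (only parsing).
Notation v_bh := 14 (only parsing).
Notation v_bj := 15 (only parsing).
Notation v_i := 16 (only parsing).
Notation v_j := 17 (only parsing).
Notation v_h := 18 (only parsing).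
Notation v_t := 19 (only parsing).
Notation v_c := 20 (only parsing).
Notation v_s := 21 (only parsing).
Notation v_d := 22 (only parsing).
Notation v_best := 23 (only parsing).
Notation v_next := 24 (only parsing).
Notation v_m := 25 (only parsing).
Notation v_n := 26 (only parsing).
Notation v_x := 27 (only parsing).

Notation a_in := 0 (only parsing).
Notation a_prod := 1 (only parsing).
Notation a_dist := 2 (only parsing).
Notation a_asg := 3 (only parsing).
Notation a_list := 4 (only parsing).
Notation a_cnt := 5 (only parsing).

(* Entries are addressed through strides held in registers, so that the same
   program also serves the transposed product [B^T A^T] when [p <= r]. *)
Definition getA (e1 e2 : expr) : expr :=
  Get a_in (EAdd (EAdd (Var v_a0) (EMul e1 (Var v_ai))) (EMul e2 (Var v_ah))).

Definition getB (e1 e2 : expr) : expr :=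
  Get a_in (EAdd (EAdd (Var v_b0) (EMul e1 (Var v_bh))) (EMul e2 (Var v_bj))).

Definition mulAB (i h j : nat) : expr :=
  EMul (getA (Var i) (Var h)) (getB (Var h) (Var j)).

(** On bits, the sum of the two truncated differences is the exclusive or. *)
Definition differ : expr :=
  EAdd (ESub (getA (Var v_i) (Var v_h)) (getA (Var v_c) (Var v_h)))
       (ESub (getA (Var v_c) (Var v_h)) (getA (Var v_i) (Var v_h))).

Definition dot : cmd :=
  Seq (Set_ v_s (Cst 0))
    (For v_h v_q (Set_ v_s (EAdd (Var v_s) (mulAB v_c v_h v_j)))).

Definition dist : cmd :=
  Seq (Set_ v_d (Cst 0)) (For v_h v_q (Set_ v_d (EAdd (Var v_d) differ))).

Definition at_row (i j n : nat) : expr := EAdd (EMul (Var i) (Var n)) (Var j).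

(** The table is indexed by the row number of the centre, not by its rank among the centres; the
    number stored in [a_asg] thus gives access to both the row and its products. *)
Definition products : cmd :=
  For v_j v_r (Seq dot (Put a_prod (at_row v_c v_j v_r) (Var v_s))).

Definition dist_i : expr := Get a_dist (Var v_i).

Definition scan : cmd :=
  Seq (Set_ v_best (Cst 0)) (Seq (Set_ v_next (Cst 0))
    (For v_i v_p
      (Seq dist
      (Seq (If (ESub dist_i (Var v_d))
              (Seq (Put a_dist (Var v_i) (Var v_d)) (Put a_asg (Var v_i) (Var v_c))))
           (If (ESub dist_i (Var v_best))
              (Seq (Set_ v_best dist_i) (Set_ v_next (Var v_i)))))))).

Definition round : cmd := Seq products (Seq scan (Set_ v_c (Var v_next))).

(** The initial value q + 1 exceeds every Hamming distance, so the first round assigns all rows to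
    centre 0. A distance of at most q therefore signals an assigned row, and [cl_asg] relies on
    this. *)
Definition cluster : cmd :=
  Seq (For v_i v_p (Put a_dist (Var v_i) (EAdd (Var v_q) (Cst 1))))
    (Seq (Set_ v_c (Cst 0)) (For v_t v_l round)).

Definition diff_lists : cmd :=
  For v_i v_p
    (Seq (Set_ v_c (Get a_asg (Var v_i)))
    (Seq (Set_ v_n (Cst 0))
    (Seq (For v_h v_q
           (If differ
              (Seq (Put a_list (at_row v_i v_n v_q) (Var v_h))
                   (Set_ v_n (EAdd (Var v_n) (Cst 1))))))
         (Put a_cnt (Var v_i) (Var v_n))))).

(** Subtraction truncates at 0, so positive and negative corrections are collected separately and
    subtracted once at the end. *)
Definition answer : cmd :=
  Seq (Set_ v_c (Get a_asg (Var v_i)))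
  (Seq (Set_ v_n (Get a_cnt (Var v_i)))
  (Seq (Set_ v_s (Get a_prod (at_row v_c v_j v_r)))
  (Seq (Set_ v_m (Cst 0))
  (Seq (For v_x v_n
          (Seq (Set_ v_h (Get a_list (at_row v_i v_x v_q)))
          (Seq (Set_ v_s (EAdd (Var v_s) (mulAB v_i v_h v_j)))
               (Set_ v_m (EAdd (Var v_m) (mulAB v_c v_h v_j))))))
       (Set_ 0 (ESub (Var v_s) (Var v_m))))))).

Lemma iotaS n : iota 0 n.+1 = rcons (iota 0 n) n.
Proof. by rewrite -addn1 iotaD cats1. Qed.

Lemma sum_iotaS (F : nat -> nat) n :
  \sum_(h <- iota 0 n.+1) F h = \sum_(h <- iota 0 n) F h + F n.
Proof. by rewrite iotaS -cats1 big_cat big_seq1. Qed.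

Lemma leq_sum_size (F : nat -> nat) s :
  (forall h, F h <= 1) -> \sum_(h <- s) F h <= size s.
Proof.
by move=> HF; rewrite -sum1_size; apply: leq_sum.
Qed.

Definition params : seq nat :=
  [:: v_p; v_q; v_r; v_l; v_a0; v_ai; v_ah; v_b0; v_bh; v_bj].

Section Algorithm.

(** The matrices are functions on naturals, so the transposed problem is an instance of this section
    with swapped arguments, without casts between ordinal types. *)
Variables (V base p q r l : nat) (a b : nat -> nat -> bool).
Hypothesis V_big : p * q + p * r + p + 2 * q + r + l + 100 < V.

Record env (st : state) : Prop := Env {
  env_p : vr st v_p = p;
  env_q : vr st v_q = q;
  env_r : vr st v_r = r;
  env_l : vr st v_l = l;
  env_A : forall i h, i < p -> h < q ->
    let x := vr st v_a0 + i * vr st v_ai + h * vr st v_ah in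
    ar st a_in x = a i h /\ x < V;
  env_B : forall h j, h < q -> j < r ->
    let x := vr st v_b0 + h * vr st v_bh + j * vr st v_bj in
    ar st a_in x = b h j /\ x < V }.

Lemma env_agree xs bs st st' :
  agree xs bs st st' -> all (fun x => x \notin xs) params -> a_in \notin bs ->
  env st -> env st'.
Proof.
move=> [Hv Ha _] /=.
case/andP=> /Hv Hp /andP[/Hv Hq /andP[/Hv Hr /andP[/Hv Hl]]].
case/andP=> /Hv Ha0 /andP[/Hv Hai /andP[/Hv Hah]].
case/andP=> /Hv Hb0 /andP[/Hv Hbh /andP[/Hv Hbj _]] /Ha E [Ep Eq Er El EA EB].
split; [congruence .. | |].
  by move=> i h Hi Hh; rewrite Ha0 Hai Hah E; apply: EA.
by move=> h j Hh Hj; rewrite Hb0 Hbh Hbj E; apply: EB.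
Qed.

Lemma env_setv st x v : env st -> x \notin params -> env (setv st x v).
Proof.
move=> E Hx; apply: (env_agree (@agree_setv x [::] [::] st v)) E => //.
by apply/allP => y Hy; rewrite inE; apply: contraNneq Hx => <-.
Qed.

Lemma getA_ok st e1 e2 : env st -> safe V base st e1 -> safe V base st e2 ->
  eval st e1 < p -> eval st e2 < q ->
  safe V base st (getA e1 e2) /\
  eval st (getA e1 e2) = a (eval st e1) (eval st e2).
Proof.
move=> E S1 S2 H1 H2; have [Ea Hlt] := env_A E H1 H2.
by split=> //=; do ?split => //; lia.
Qed.

Lemma getB_ok st e1 e2 : env st -> safe V base st e1 -> safe V base st e2 ->
  eval st e1 < q -> eval st e2 < r ->
  safe V base st (getB e1 e2) /\
  eval st (getB e1 e2) = b (eval st e1) (eval st e2).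
Proof.
move=> E S1 S2 H1 H2; have [Ea Hlt] := env_B E H1 H2.
by split=> //=; do ?split => //; lia.
Qed.

Lemma mulAB_ok st i h j : env st ->
  vr st i < p -> vr st h < q -> vr st j < r ->
  safe V base st (mulAB i h j) /\
  eval st (mulAB i h j) = a (vr st i) (vr st h) * b (vr st h) (vr st j).
Proof.
move=> E Hi Hh Hj.
have [SA EA] := @getA_ok st (Var i) (Var h) E I I Hi Hh.
have [SB EB] := @getB_ok st (Var h) (Var j) E I I Hh Hj.
rewrite /mulAB /safe -/safe /eval -/eval EA EB /=; split=> //; split=> //.
by case: (a _ _); case: (b _ _); lia.
Qed.

Lemma differ_ok st : env st ->
  vr st v_i < p -> vr st v_c < p -> vr st v_h < q ->
  safe V base st differ /\
  eval st differ =
    (a (vr st v_i) (vr st v_h) != a (vr st v_c) (vr st v_h)).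
Proof.
move=> E Hi Hc Hh.
have [SA EA] := @getA_ok st (Var v_i) (Var v_h) E I I Hi Hh.
have [SC EC] := @getA_ok st (Var v_c) (Var v_h) E I I Hc Hh.
rewrite /differ /safe -/safe /eval -/eval EA EC /=; split.
  by do ?split => //; case: (a _ _); case: (a _ _); lia.
by case: (a _ _); case: (a _ _).
Qed.

(** The last argument, here and in [diffs], is the length of the prefix already treated, which makes
    both usable as loop invariants. *)
Definition dotn (c j n : nat) : nat := \sum_(h <- iota 0 n) a c h * b h j.

Definition diffs (i c n : nat) : seq nat :=
  [seq h <- iota 0 n | a i h != a c h].

Definition hamn (i c : nat) : nat := size (diffs i c q).

Lemma leq_bits (x y : bool) : x * y <= 1.
Proof. by case: x; case: y. Qed.

Lemma leq_dotn c j n : dotn c j n <= n.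
Proof.
rewrite -{2}(size_iota 0 n); apply: leq_sum_size => h; exact: leq_bits.
Qed.

Lemma diffsS i c n : diffs i c n.+1 =
  if a i n != a c n then rcons (diffs i c n) n else diffs i c n.
Proof. by rewrite /diffs iotaS filter_rcons. Qed.

Lemma size_diffs i c n : size (diffs i c n) <= n.
Proof. by rewrite -{2}(size_iota 0 n) size_filter count_size. Qed.

Lemma dot_ok st : env st -> vr st v_c < p -> vr st v_j < r ->
  ok V base dot st (3 * q + 3)
    (fun st' => vr st' v_s = dotn (vr st v_c) (vr st v_j) q).
Proof.
move=> E Hc Hj; rewrite addnS; apply: ok_set_seq => /=; first by lia.
set st0 := setv _ _ _.
apply: (ok_weaken (@ok_for V base v_h v_q _ st0 q 1
  (fun x st1 => vr st1 v_s = dotn (vr st v_c) (vr st v_j) x) _ _ _ _ _ _)) => //.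
- exact: env_q E.
- by lia.
- by rewrite /= /dotn big_nil.
- move=> x st1 Hx A Eh Es.
  have E1 : env st1.
    by apply: (env_agree A) => //; apply: env_setv.
  have [Av _ _] := A.
  have Ec1 : vr st1 v_c = vr st v_c by apply: (Av v_c).
  have Ej1 : vr st1 v_j = vr st v_j by apply: (Av v_j).
  have := @mulAB_ok st1 v_c v_h v_j E1; rewrite Ec1 Ej1 Eh => /(_ Hc Hx Hj) [S EM].
  apply: ok_set.
    split=> //; rewrite [eval st1 (Var _)]/= EM Es.
    have := leq_dotn (vr st v_c) (vr st v_j) x.
    have := leq_bits (a (vr st v_c) x) (b x (vr st v_j)); lia.
  rewrite /= in EM *; rewrite EM Es /dotn sum_iotaS //.
- by lia.
- by move=> st' _ [].
Qed.

Lemma dist_ok st : env st -> vr st v_i < p -> vr st v_c < p ->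
  ok V base dist st (3 * q + 3)
    (fun st' => vr st' v_d = hamn (vr st v_i) (vr st v_c)).
Proof.
move=> E Hi Hc; rewrite addnS; apply: ok_set_seq => /=; first by lia.
set st0 := setv _ _ _.
apply: (ok_weaken (@ok_for V base v_h v_q _ st0 q 1
  (fun x st1 => vr st1 v_d = size (diffs (vr st v_i) (vr st v_c) x))
  _ _ _ _ _ _)) => //.
- exact: env_q E.
- by lia.
- move=> x st1 Hx A Eh Es.
  have E1 : env st1.
    by apply: (env_agree A) => //; apply: env_setv.
  have [Av _ _] := A.
  have Ei1 : vr st1 v_i = vr st v_i by apply: (Av v_i).
  have Ec1 : vr st1 v_c = vr st v_c by apply: (Av v_c).
  have := @differ_ok st1 E1; rewrite Ei1 Ec1 Eh => /(_ Hi Hc Hx) [S EM].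
  apply: ok_set.
    split=> //; rewrite [eval st1 (Var _)]/= EM Es.
    have := size_diffs (vr st v_i) (vr st v_c) x.
    by case: (_ != _); lia.
  rewrite /= in EM *; rewrite EM Es diffsS.
  by case: ifP => _; rewrite ?size_rcons ?addn1 ?addn0.
- by lia.
- by move=> st' _ [].
Qed.

Lemma flat_index_inj n u v i j :
  i < n -> j < n -> u * n + i = v * n + j -> u = v /\ i = j.
Proof.
move=> Hi Hj E; have n_gt0 : 0 < n by lia.
have := congr1 (divn^~ n) E; have := congr1 (modn^~ n) E.
by rewrite /= !modnMDl !modn_small // !divnMDl // !divn_small // !addn0.
Qed.

Lemma at_row_ok st i j n N : vr st n <= q \/ vr st n <= r ->
  vr st i < p -> vr st j < vr st n -> N = vr st n ->
  safe V base st (at_row i j n) /\ eval st (at_row i j n) = vr st i * N + vr st j.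
Proof.
move=> Hn Hi Hj ->; split=> //=.
have H : vr st i * vr st n + vr st j < V.
  case: Hn => Hn.
    have : vr st i * vr st n + vr st j <= p * q by nia.
    by lia.
  have : vr st i * vr st n + vr st j <= p * r by nia.
  by lia.
by do ?split => //; lia.
Qed.

Definition prod_ok (st : state) (u : nat) : Prop :=
  forall j, j < r -> ar st a_prod (u * r + j) = dotn u j q.

(** Earlier centres keep their products. This includes a centre chosen again, which happens when all
    distances are 0: its entries are overwritten by equal values. *)
Lemma products_ok st : env st -> vr st v_c < p ->
  ok V base products st (r * (3 * q + 6) + 2)
    (fun st' => forall u, u = vr st v_c \/ prod_ok st u -> prod_ok st' u).
Proof.
move=> E Hc.
apply: (ok_weaken (@ok_for V base v_j v_r _ st r (3 * q + 3 + 1)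
  (fun x st1 => forall u j, j < r -> (u = vr st v_c /\ j < x) \/ prod_ok st u ->
     ar st1 a_prod (u * r + j) = dotn u j q) _ _ _ _ _ _)) => //.
- exact: env_r E.
- by lia.
- by move=> u j Hj [[]//|]; apply.
- move=> x st1 Hx A Ej HI.
  have E1 : env st1 by apply: (env_agree A).
  have [Av _ _] := A.
  have Ec1 : vr st1 v_c = vr st v_c by apply: (Av v_c).
  apply: ok_seq; have := dot_ok E1; rewrite Ec1 Ej => /(_ Hc Hx) H.
  apply: (ok_weaken H) => // st2 A2 Es.
  have E2 : env st2 by apply: (env_agree A2).
  have [Av2 Aa2 _] := A2.
  have Ec2 : vr st2 v_c = vr st v_c by rewrite -Ec1; apply: (Av2 v_c).
  have Ej2 : vr st2 v_j = x by rewrite -Ej; apply: (Av2 v_j).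
  have Er2 := env_r E2.
  have [S2 Ev2] : safe V base st2 (at_row v_c v_j v_r) /\
      eval st2 (at_row v_c v_j v_r) = vr st v_c * r + x.
    by rewrite -{1}Ec2 -{1}Ej2; apply: at_row_ok; rewrite ?Er2 ?Ec2 ?Ej2 //; right.
  apply: ok_put => //; rewrite Ev2 => u j Hj Hu.
  have -> : eval st2 (Var v_s) = dotn (vr st v_c) x q by [].
  rewrite /= /upd; case: eqP => [/flat_index_inj|ne].
    by case/(_ Hj Hx) => -> ->.
  rewrite (Aa2 a_prod) //; apply: HI => //.
  case: Hu => [[Eu Hjx]|]; last by right.
  left; split=> //; rewrite ltnS leq_eqVlt in Hjx.
  by case/orP: Hjx => // /eqP Ejx; case: ne; rewrite Eu Ejx.
- by lia.
- move=> st' _ [H _] u Hu j Hj; apply: H => //.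
  by case: Hu => [->|Hu]; [left | right].
Qed.

Definition scanned (c n : nat) (st st' : state) : Prop :=
  (forall i, ar st' a_dist i = if i < n then minn (ar st a_dist i) (hamn i c)
                               else ar st a_dist i) /\
  (forall i, ar st' a_asg i =
     if (i < n) && (hamn i c < ar st a_dist i) then c else ar st a_asg i).

Lemma scan_ok st : env st -> vr st v_c < p ->
  ok V base scan st (p * (3 * q + 12) + 4)
    (fun st' => [/\ scanned (vr st v_c) p st st', vr st' v_next < p &
       forall i, i < p -> ar st' a_dist i <= ar st' a_dist (vr st' v_next)]).
Proof.
move=> E Hc; rewrite [_ + 4]addnS; apply: ok_set_seq => /=; first by lia.
rewrite addnS; apply: ok_set_seq => /=; first by lia.
set st0 := setv _ _ _.
(* Either the recorded row attains [best], or [best] is still 0; then all distances seen are 0 and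
   the default row 0 is as far as any other. *)
pose Inv x st1 := [/\ scanned (vr st v_c) x st st1, vr st1 v_next < p,
  vr st1 v_best = 0 \/
    vr st1 v_next < x /\ ar st1 a_dist (vr st1 v_next) = vr st1 v_best &
  forall i, i < x -> ar st1 a_dist i <= vr st1 v_best].
apply: (ok_weaken (@ok_for V base v_i v_p _ st0 p (3 * q + 3 + (3 + 3))
  Inv _ _ _ _ _ _)) => //.
- exact: env_p E.
- by lia.
- by split=> //=; [lia | left].
- move=> x st1 Hx A Ei [[Hd Ha] Hn Hb Hle].
  have E1 : env st1 by apply: (env_agree A) => //; do 2! apply: env_setv => //.
  have [Av _ _] := A.
  have Ec1 : vr st1 v_c = vr st v_c by apply: (Av v_c).
  apply: ok_seq; have := dist_ok E1; rewrite Ec1 Ei => /(_ Hx Hc) H.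
  apply: (ok_weaken H) => // st2 A2 Es.
  have E2 : env st2 by apply: (env_agree A2).
  have [Av2 Aa2 _] := A2.
  have Ec2 : vr st2 v_c = vr st v_c by rewrite -Ec1; apply: (Av2 v_c).
  have Ei2 : vr st2 v_i = x by rewrite -Ei; apply: (Av2 v_i).
  have En2 : vr st2 v_next = vr st1 v_next by apply: (Av2 v_next).
  have Eb2 : vr st2 v_best = vr st1 v_best by apply: (Av2 v_best).
  have Ed2 : ar st2 a_dist = ar st1 a_dist by apply: (Aa2 a_dist).
  have Ea2 : ar st2 a_asg = ar st1 a_asg by apply: (Aa2 a_asg).
  have Hdx : ar st1 a_dist x = ar st a_dist x by rewrite Hd ltnn.
  apply: ok_seq.
  have H3 : ok V base
      (If (ESub dist_i (Var v_d))
         (Seq (Put a_dist (Var v_i) (Var v_d)) (Put a_asg (Var v_i) (Var v_c))))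
      st2 3
      (fun st3 => [/\ scanned (vr st v_c) x.+1 st st3,
         vr st3 = vr st2 & forall i, i != x -> ar st3 a_dist i = ar st1 a_dist i]).
    apply: ok_if => //= H3.
      apply: ok_put_seq => //; apply: ok_put => //; split=> //; first split.
      + move=> i /=; rewrite Ei2 Ed2 Es /upd Hd ltnS.
        case: (ltngtP i x) => // ->; move: H3; rewrite Ei2 Ed2 Es Hdx; lia.
      + move=> i /=; rewrite Ei2 Ea2 Ec2 /upd Ha ltnS.
        case: (ltngtP i x) => //= ->; move: H3; rewrite Ei2 Ed2 Es Hdx.
        by rewrite subn_gt0 => ->.
      + by move=> i /negPf Hi /=; rewrite Ei2 Ed2 /upd Hi.
    rewrite Ei2 Ed2 Es Hdx in H3.
    split=> //; last by rewrite Ed2.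
    split=> i; [rewrite Ed2 Hd ltnS | rewrite Ea2 Ha ltnS].
      by case: (ltngtP i x) => // ->; lia.
    case: (ltngtP i x) => //= ->; case: ifP => //; lia.
  apply: (ok_weaken H3) => // st3 _ [S3 Ev3 Hd3].
  have Hd3i i : i < x -> ar st3 a_dist i <= vr st1 v_best.
    by move=> Hi; rewrite Hd3 ?Hle //; lia.
  apply: ok_if => //= H4.
    apply: ok_set_seq => //; apply: ok_set => //.
    rewrite /= /upd /= Ev3 Ei2; split=> //=; first by right.
    rewrite Ev3 Ei2 Eb2 subn_gt0 in H4.
    move=> i; rewrite ltnS leq_eqVlt => /predU1P[->//|/Hd3i Hi].
    by apply: leq_trans (ltnW H4).
  rewrite Ev3 Ei2 Eb2 in H4.
  split; rewrite /= /upd /= ?Ev3 ?En2 ?Eb2 //.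
    case: Hb => [|[Hb1 Hb2]]; [by left | right; split; first by lia].
    by rewrite Hd3 //; lia.
  move=> i; rewrite ltnS leq_eqVlt => /predU1P[->//|/Hd3i //]; lia.
- by lia.
- move=> st' _ [[S Hn Hb Hle] _]; split=> // i /Hle Hi.
  by case: Hb => [Hb|[_ ->]] //; lia.
Qed.

Lemma hamnC i c : hamn i c = hamn c i.
Proof. by congr size; apply: eq_filter => h; rewrite eq_sym. Qed.

Lemma hamn_le i c : hamn i c <= q.
Proof. exact: size_diffs. Qed.

(* [cs] are the centres used so far and [c] the next one, a row farthest from
   them; [cl_far] is the invariant of farthest-point clustering. *)
Record clustered (st : state) (c : nat) (cs : seq nat) : Prop := Clustered {
  cl_lt : all (fun u => u < p) cs;
  cl_far : pairwise (fun u v => ar st a_dist c <= hamn u v) cs;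
  cl_max : forall i, i < p -> ar st a_dist i <= ar st a_dist c;
  cl_le : forall i u, i < p -> u \in cs -> ar st a_dist i <= hamn i u;
  cl_asg : forall i, i < p -> ar st a_dist i <= q ->
    ar st a_asg i \in cs /\ hamn i (ar st a_asg i) = ar st a_dist i;
  cl_prod : forall u, u \in cs -> prod_ok st u }.

(** Distances to the set of centres only shrink, so the new maximum is at most the old one and pairs
    that were far enough remain so. The centre added is at least the old maximum away from every
    earlier one. *)
Lemma round_ok st cs : env st -> vr st v_c < p -> clustered st (vr st v_c) cs ->
  ok V base round st (r * (3 * q + 6) + 2 + (p * (3 * q + 12) + 4 + 1))
    (fun st' => vr st' v_c < p /\
       clustered st' (vr st' v_c) (rcons cs (vr st v_c))).
Proof.
move=> E Hc [Clt Cfar Cmax Cle Casg Cprod].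
apply: ok_seq; apply: (ok_weaken (products_ok E Hc)) => // st1 A1 P1.
have E1 : env st1 by apply: (env_agree A1).
have [Av Aa _] := A1.
have Ec1 : vr st1 v_c = vr st v_c by apply: (Av v_c).
have Ed1 : ar st1 a_dist = ar st a_dist by apply: (Aa a_dist).
have Ea1 : ar st1 a_asg = ar st a_asg by apply: (Aa a_asg).
have Hc1 : vr st1 v_c < p by rewrite Ec1.
apply: ok_seq; apply: (ok_weaken (scan_ok E1 Hc1)) => // st2 [_ Aa2 _].
rewrite Ec1 /scanned Ed1 Ea1; case=> -[Hd Ha] Hn Hmax.
apply: ok_set => //; split=> //=.
set c := vr st v_c in Hc P1 Ec1 Hd Ha Hmax Cmax Cfar *.
set c' := vr st2 v_next in Hn Hmax *.
have Hd_le i : i < p -> ar st2 a_dist i <= ar st a_dist i.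
  by move=> Hi; rewrite Hd Hi geq_minl.
have Hc'c : ar st2 a_dist c' <= ar st a_dist c.
  exact: leq_trans (Hd_le _ Hn) (Cmax _ Hn).
split=> /=.
- by rewrite all_rcons Hc.
- rewrite pairwise_rcons; apply/andP; split.
    apply/allP => u Hu; apply: leq_trans Hc'c _; rewrite hamnC; exact: Cle.
  by apply: sub_pairwise Cfar => u v; apply: leq_trans.
- exact: Hmax.
- move=> i u Hi; rewrite mem_rcons inE => /predU1P[->|Hu].
    by rewrite Hd Hi geq_minr.
  exact: leq_trans (Hd_le _ Hi) (Cle _ _ Hi Hu).
- move=> i Hi; rewrite Ha Hd Hi /= mem_rcons inE.
  case: ltnP => Hlt Hq.
    by rewrite eqxx; split=> //; lia.
  have [|-> ->] := Casg _ Hi; first by lia.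
  by rewrite orbT; split=> //; lia.
- move=> u; rewrite mem_rcons inE => Hu j Hj /=.
  rewrite (Aa2 a_prod) //; apply: P1 => //.
  by case/predU1P: Hu => [->|/Cprod]; [left | right].
Qed.

Lemma cluster_ok st : env st -> 0 < p ->
  ok V base cluster st
    (p * (1 + 2) + 2 +
     (l * (r * (3 * q + 6) + 2 + (p * (3 * q + 12) + 4 + 1) + 2) + 2).+1)
    (fun st' => vr st' v_c < p /\
       exists2 cs, size cs = l & clustered st' (vr st' v_c) cs).
Proof.
move=> E p_gt0; apply: ok_seq.
apply: (ok_weaken (@ok_for V base v_i v_p _ st p 1
  (fun x st1 => forall i, i < x -> ar st1 a_dist i = q.+1) _ _ _ _ _ _)) => //.
- exact: env_p E.
- by lia.
- move=> x st1 Hx A Ei HI.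
  have E1 : env st1 by apply: (env_agree A).
  have Eq := env_q E1.
  apply: ok_put => //=; first by rewrite Eq; split=> //; lia.
  move=> i; rewrite Ei Eq addn1 ltnS leq_eqVlt; case: eqP => // _; exact: HI.
move=> st1 _ [Hd A1].
have E1 : env st1 by apply: (env_agree A1).
apply: ok_set_seq => /=; first by lia.
set st2 := setv _ _ _.
have E2 : env st2 by apply: env_setv.
apply: (ok_weaken (@ok_for V base v_t v_l _ st2 l _
  (fun t st3 => vr st3 v_c < p /\
       exists2 cs, size cs = t & clustered st3 (vr st3 v_c) cs)
   _ _ _ _ _ _)) => //.
- exact: env_l E2.
- by lia.
(* Without centres every distance is the initial q + 1, so [cl_max] is an equality and [cl_asg] is
   vacuous. *)
- split=> //; exists [::] => //; split=> //= i Hi; rewrite !Hd //; lia.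
- move=> t st3 Ht A3 Et [Hc [cs Hcs C]].
  have E3 : env st3 by apply: (env_agree A3).
  apply: (ok_weaken (round_ok E3 Hc C)) => // st4 _ [Hc4 C4].
  split=> //; exists (rcons cs (vr st3 v_c)); first by rewrite size_rcons Hcs.
  by case: C4.
- by move=> st3 _ [].
Qed.

Definition listed (st : state) (i : nat) : Prop :=
  let L := diffs i (ar st a_asg i) q in
  ar st a_cnt i = size L /\
  forall x, x < size L -> ar st a_list (i * q + x) = nth 0 L x.

Lemma diff_lists_ok st : env st -> (forall i, i < p -> ar st a_asg i < p) ->
  ok V base diff_lists st (p * (5 * q + 7) + 2)
    (fun st' => forall i, i < p -> listed st' i).
Proof.
move=> E Hasg.
apply: (ok_weaken (@ok_for V base v_i v_p _ st p (q * (3 + 2) + 2 + 1).+2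
  (fun x st1 => forall i, i < x -> listed st1 i) _ _ _ _ _ _)) => //.
- exact: env_p E.
- by lia.
- move=> x st1 Hx A Ei HI.
  have E1 : env st1 by apply: (env_agree A).
  have [_ Aa _] := A.
  have Ea1 : ar st1 a_asg = ar st a_asg by apply: (Aa a_asg).
  apply: ok_set_seq => //; rewrite [eval _ _]/= Ei Ea1.
  apply: ok_set_seq => /=; first by lia.
  set c := ar st a_asg x; set st2 := setv _ _ _.
  have Hc : c < p := Hasg _ Hx.
  have E2 : env st2 by do 2! apply: env_setv => //.
  (* Lists have length at most q, so those of earlier rows lie below address [x * q]; the last
     clause preserves them. *)
  pose Inv h st3 := [/\ vr st3 v_n = size (diffs x c h),
    forall y, y < vr st3 v_n -> ar st3 a_list (x * q + y) = nth 0 (diffs x c h) y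
    & forall t, t < x * q -> ar st3 a_list t = ar st1 a_list t].
  apply: ok_seq; apply: (ok_weaken (@ok_for V base v_h v_q _ st2 q 3
    Inv _ _ _ _ _ _)) => //.
  + exact: env_q E2.
  + by lia.
  + move=> h st3 Hh A3 Eh [Hn Hl Ht].
    have E3 : env st3 by apply: (env_agree A3).
    have [Av3 _ _] := A3.
    have Ei3 : vr st3 v_i = x by rewrite -Ei; apply: (Av3 v_i).
    have Ec3 : vr st3 v_c = c by apply: (Av3 v_c).
    have := @differ_ok st3 E3; rewrite Ei3 Ec3 Eh => /(_ Hx Hc Hh) [S EM].
    have Hnh : vr st3 v_n < q.
      by rewrite Hn (leq_ltn_trans (size_diffs _ _ _)).
    apply: ok_if => //; rewrite EM.
      rewrite lt0b => Hdiff.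
      have Eq3 := env_q E3.
      have [Sr Er] : safe V base st3 (at_row v_i v_n v_q) /\
          eval st3 (at_row v_i v_n v_q) = x * q + vr st3 v_n.
        by rewrite -{1}Ei3; apply: at_row_ok; rewrite ?Eq3 ?Ei3 //; left.
      apply: ok_put_seq => //; rewrite Er; apply: ok_set => /=.
        by do ?split => //; lia.
      split=> /=; rewrite ?diffsS ?Hdiff.
      * by rewrite size_rcons Hn addn1.
      * move=> y; rewrite eqn_add2l nth_rcons -Hn Eh addn1 ltnS leq_eqVlt.
        by case: (ltngtP y (vr st3 v_n)) => // Hy _; apply: Hl.
      * move=> t Hlt; rewrite ifF; first exact: Ht.
        by move: Hlt; clear; lia.
    move=> Hdiff; split=> /=; rewrite ?diffsS //; rewrite (_ : (_ != _) = false) //;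
      by case: (_ != _) Hdiff.
  + move=> st3 A3 [[Hn Hl Ht] _].
    have [Av3 Aa3 _] := A3.
    have Ei3 : vr st3 v_i = x by rewrite -Ei; apply: (Av3 v_i).
    have Ea3 : ar st3 a_asg = ar st a_asg by rewrite -Ea1; apply: (Aa3 a_asg).
    have Ec3 : ar st3 a_cnt = ar st1 a_cnt by apply: (Aa3 a_cnt).
    apply: ok_put => //; rewrite [eval _ _]/= [eval _ _]/= => i.
    rewrite ltnS leq_eqVlt /listed /= Ei3 Ea3 Ec3.
    case/predU1P => [->|Hi].
      by rewrite eqxx Hn; split=> // y Hy; apply: Hl; rewrite Hn.
    have [H1 H2] := HI _ Hi; rewrite Ea1 in H1 H2.
    rewrite ifF; last by lia.
    split=> // y Hy; rewrite Ht ?H2 //.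
    have := size_diffs i (ar st a_asg i) q; nia.
- by lia.
- by move=> st' _ [].
Qed.

Record prepared (st : state) (D : nat) : Prop := Prepared {
  pr_env : env st;
  pr_asg : forall i, i < p -> ar st a_asg i < p;
  pr_ham : forall i, i < p -> hamn i (ar st a_asg i) <= D;
  pr_prod : forall i, i < p -> prod_ok st (ar st a_asg i);
  pr_list : forall i, i < p -> listed st i }.

Lemma prepare_ok st : env st -> 0 < p -> 0 < l ->
  ok V base (Seq cluster diff_lists) st
    (l * (r * (3 * q + 6) + p * (3 * q + 12) + 9) + p * (5 * q + 10) + 7)
    (fun st' => exists D cs, [/\ prepared st' D, D <= q, size cs = l.+1,
       all (fun u => u < p) cs & pairwise (fun u v => D <= hamn u v) cs]).
Proof.
move=> E p_gt0 l_gt0.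
apply: (@ok_weaken V base _ _ _ _ _ _ (ok_seq (n2 := p * (5 * q + 7) + 2)
  (Q := fun st' => exists D cs, [/\ prepared st' D, D <= q, size cs = l.+1,
       all (fun u => u < p) cs & pairwise (fun u v => D <= hamn u v) cs]) _)).
- apply: (ok_weaken (cluster_ok E p_gt0)); first exact: leqnn.
  move=> st1 A1 [Hc [cs Hcs C]].
  have E1 : env st1 by apply: (env_agree A1).
  (* As l > 0, there is at least one centre, and the initial value q + 1 has been replaced
     everywhere. *)
  have Dq i : i < p -> ar st1 a_dist i <= q.
    move=> Hi; case: cs Hcs C => [|u cs _ C].
      by move=> H; move: l_gt0; rewrite -H.
    by apply: leq_trans (cl_le C Hi (mem_head _ _)) (hamn_le _ _).
  have Hasg i : i < p -> ar st1 a_asg i \in cs.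
    by move=> Hi; case: (cl_asg C Hi (Dq _ Hi)).
  have Hasgp i : i < p -> ar st1 a_asg i < p.
    by move=> Hi; apply: (allP (cl_lt C)); apply: Hasg.
  apply: (ok_weaken (diff_lists_ok E1 Hasgp)); first exact: leqnn.
  move=> st2 A2 HL; have [_ Aa2 _] := A2.
  have E2 : env st2 by apply: (env_agree A2).
  have Ea2 : ar st2 a_asg = ar st1 a_asg by apply: (Aa2 a_asg).
  (* After l rounds [v_c] holds the row that would become the next centre: it is the additional row,
     and its distance is D. *)
  exists (ar st1 a_dist (vr st1 v_c)), (rcons cs (vr st1 v_c)); split.
  + split=> // i Hi; rewrite ?Ea2; first exact: Hasgp.
      by have [_ ->] := cl_asg C Hi (Dq _ Hi); apply: (cl_max C).
    by move=> j Hj; rewrite (Aa2 a_prod) //; apply: (cl_prod C) => //; apply: Hasg.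
  + exact: Dq.
  + by rewrite size_rcons Hcs.
  + by rewrite all_rcons Hc (cl_lt C).
  + rewrite pairwise_rcons (cl_far C) andbT; apply/allP => u Hu.
    by rewrite hamnC (cl_le C).
- by lia.
- by [].
Qed.

(* Replacing row [c] by row [i] changes only the terms of [diffs i c q]. *)
Lemma dotn_diffs i c j s :
  \sum_(h <- s) a c h * b h j + \sum_(h <- [seq h <- s | a i h != a c h]) a i h * b h j
  = \sum_(h <- s) a i h * b h j +
    \sum_(h <- [seq h <- s | a i h != a c h]) a c h * b h j.
Proof.
elim: s => [|h s IH]; first by rewrite !big_nil.
rewrite /= !big_cons; case: eqP => [->|_] /=; rewrite ?big_cons; lia.
Qed.

Lemma answer_ok st D : prepared st D -> vr st v_i < p -> vr st v_j < r ->
  ok V base answer st (5 * D + 7)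
    (fun st' => vr st' 0 = dotn (vr st v_i) (vr st v_j) q).
Proof.
move=> [E Hasg Hham Hprod Hlist] Hi Hj.
set i := vr st v_i in Hi *; set j := vr st v_j in Hj *.
pose c := ar st a_asg i; pose L := diffs i c q.
have Hc : c < p := Hasg _ Hi.
have HD : size L <= D := Hham _ Hi.
have [Hcnt Hl] := Hlist _ Hi.
have HLq : size L <= q := size_diffs _ _ _.
(* Four assignments precede the loop; its body costs 3, to which [ok_for] adds 2. *)
rewrite (_ : 5 * D + 7 = (5 * D + 3).+4); last by lia.
apply: ok_set_seq => //; apply: ok_set_seq => //.
set st2 := setv _ _ _.
have E2 : env st2 by do 2! apply: env_setv => //.
have [S Er] : safe V base st2 (at_row v_c v_j v_r) /\
    eval st2 (at_row v_c v_j v_r) = c * r + j.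
  by apply: at_row_ok; rewrite /= ?(env_r E) //; right.
apply: ok_set_seq => //.
have -> : eval st2 (Get a_prod (at_row v_c v_j v_r)) = dotn c j q.
  by rewrite /eval -/eval Er; apply: Hprod.
apply: ok_set_seq => /=; first by lia.
set st3 := setv _ _ _.
have E3 : env st3 by do 2! apply: env_setv => //.
pose Inv x st4 :=
  vr st4 v_s = dotn c j q + \sum_(h <- take x L) a i h * b h j /\
  vr st4 v_m = \sum_(h <- take x L) a c h * b h j.
rewrite -addn2 -(addn1 2) addnA; apply: ok_seq.
apply: (ok_weaken (@ok_for V base v_x v_n _ st3 (size L) 3 Inv _ _ _ _ _ _)) => //.
- by lia.
- by split; rewrite /= take0 big_nil ?addn0.
- move=> x st4 Hx A4 Ex [Hs Hm].
  have E4 : env st4 by apply: (env_agree A4).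
  have [Av4 Aa4 _] := A4.
  have Ei4 : vr st4 v_i = i by apply: (Av4 v_i).
  have Ej4 : vr st4 v_j = j by apply: (Av4 v_j).
  have Ec4 : vr st4 v_c = c by apply: (Av4 v_c).
  have Eq4 := env_q E4.
  have [Sr4 Er4] : safe V base st4 (at_row v_i v_x v_q) /\
      eval st4 (at_row v_i v_x v_q) = i * q + x.
    rewrite -{1}Ei4 -{1}Ex; apply: at_row_ok; rewrite ?Eq4 ?Ei4 ?Ex //; first by left.
    exact: leq_trans Hx HLq.
  apply: ok_set_seq => //.
  have -> : eval st4 (Get a_list (at_row v_i v_x v_q)) = nth 0 L x.
    by rewrite /eval -/eval Er4 (Aa4 a_list) //; apply: Hl.
  set h := nth 0 L x.
  have Hh : h < q.
    have := mem_nth 0 Hx; rewrite mem_filter mem_iota add0n.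
    by case/and3P.
  set st5 := setv _ _ _.
  have E5 : env st5 by apply: env_setv.
  have := @mulAB_ok st5 v_i v_h v_j E5.
  have Ei5 : vr st5 v_i = i := Ei4.
  have Ej5 : vr st5 v_j = j := Ej4.
  have Eh5 : vr st5 v_h = h by [].
  rewrite Ei5 Ej5 Eh5 => /(_ Hi Hh Hj) [S5 EM5].
  have Hb1 : \sum_(g <- take x L) a i g * b g j <= q.
    apply: leq_trans (leq_sum_size _ _) _ => [g|]; first exact: leq_bits.
    by rewrite size_take; case: ifP => _; lia.
  have Hb2 : \sum_(g <- take x L) a c g * b g j <= q.
    apply: leq_trans (leq_sum_size _ _) _ => [g|]; first exact: leq_bits.
    by rewrite size_take; case: ifP => _; lia.
  have Hb0 := leq_dotn c j q.
  have Hb3 := leq_bits (a i h) (b h j).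
  have Hb4 := leq_bits (a c h) (b h j).
  have Vs : eval st5 (EAdd (Var v_s) (mulAB v_i v_h v_j)) =
      dotn c j q + \sum_(h <- take x.+1 L) a i h * b h j.
    rewrite [LHS](_ : _ = vr st4 v_s + eval st5 (mulAB v_i v_h v_j)) //.
    rewrite EM5 Hs (take_nth 0 Hx) -cats1 big_cat big_seq1 /=.
    by rewrite addnA.
  have St : \sum_(g <- take x.+1 L) a i g * b g j <= q.
    apply: leq_trans (leq_sum_size _ _) _ => [g|]; first exact: leq_bits.
    by rewrite size_take; case: ifP => _; lia.
  apply: ok_set_seq.
    by split=> //; rewrite [eval st5 _ + _]Vs; lia.
  rewrite Vs; set st6 := setv _ _ _.
  have E6 : env st6 by apply: env_setv.
  have := @mulAB_ok st6 v_c v_h v_j E6.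
  have Ec6 : vr st6 v_c = c := Ec4.
  have Ej6 : vr st6 v_j = j := Ej4.
  have Eh6 : vr st6 v_h = h by [].
  rewrite Ec6 Ej6 Eh6 => /(_ Hc Hh Hj) [S6 EM6].
  have Vm : eval st6 (EAdd (Var v_m) (mulAB v_c v_h v_j)) =
      \sum_(h <- take x.+1 L) a c h * b h j.
    rewrite [LHS](_ : _ = vr st4 v_m + eval st6 (mulAB v_c v_h v_j)) //.
    by rewrite EM6 Hm (take_nth 0 Hx) -cats1 big_cat big_seq1.
  have Sm : \sum_(g <- take x.+1 L) a c g * b g j <= q.
    apply: leq_trans (leq_sum_size _ _) _ => [g|]; first exact: leq_bits.
    by rewrite size_take; case: ifP => _; lia.
  apply: ok_set; last by split=> //; exact: Vm.
  by split=> //; rewrite [eval st6 _ + _]Vm; lia.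
- by lia.
- move=> st4 A4 [[Hs Hm] _]; apply: ok_set => //=.
  (* The first accumulator equals the wanted entry plus the second, so the truncated subtraction is
     exact. *)
  rewrite Hs Hm take_size (dotn_diffs i c j (iota 0 q)) -/(diffs i c q) -/L.
  by rewrite addnK.
Qed.

End Algorithm.
(** * Input and output conventions *)

(* Input cell [t + 5] is read in place when [t + 5 >= NR = 40]; the 35 cells before
   it have been moved to the addresses from [S] on, and cell 4 holds [S + 34]. *)
Definition copy_input : cmd :=
  Seq (Set_ v_s (ESub (Var 4) (Cst 34)))
  (Seq (Set_ v_n (EAdd (EMul (Var 0) (Var 1)) (EMul (Var 1) (Var 2))))
    (For v_x v_n
      (Seq (If (ESub (Cst 35) (Var v_x))
             (Put a_in (Var v_x) (Raw (EAdd (Var v_s) (Var v_x)))))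
           (If (ESub (Var v_x) (Cst 34))
             (Put a_in (Var v_x) (Raw (EAdd (Var v_x) (Cst 5)))))))).

(** In the transposed case the first factor is the transpose of B, whose entry (j, h) is input
    number p q + h r + j: row stride 1, column stride r. The final test implements [lq]. *)
Definition set_params (tr : bool) : cmd :=
  Seq (Set_ v_p (Var (if tr then 2 else 0)))
  (Seq (Set_ v_q (Var 1))
  (Seq (Set_ v_r (Var (if tr then 0 else 2)))
  (Seq (Set_ v_l (Var 3))
  (Seq (Set_ v_a0 (if tr then EMul (Var 0) (Var 1) else Cst 0))
  (Seq (Set_ v_ai (if tr then Cst 1 else Var 1))
  (Seq (Set_ v_ah (if tr then Var 2 else Cst 1))
  (Seq (Set_ v_b0 (if tr then Cst 0 else EMul (Var 0) (Var 1)))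
  (Seq (Set_ v_bh (if tr then Cst 1 else Var 2))
  (Seq (Set_ v_bj (if tr then Var 1 else Cst 1))
       (If (ESub (Cst 1) (Var v_q)) (Set_ v_l (Cst 1)))))))))))).

Definition preprocess (tr : bool) : cmd :=
  Seq copy_input (Seq (set_params tr) (Seq cluster diff_lists)).

Definition query (tr : bool) : cmd :=
  Seq (Set_ v_i (Var (if tr then 1 else 0)))
  (Seq (Set_ v_j (Var (if tr then 0 else 1))) answer).

Section Input.

Variables (V S p q r l : nat) (inp : nat -> nat).
Hypotheses (S_big : 256 <= S) (pqr_S : p * q + q * r + 5 <= S)
           (V_big : S + p + q + r + l + p * q + p * r + q * r + 300 < V).

Let base := S + 35.

Record loaded (st : state) : Prop := Loaded {
  ld_p : vr st 0 = p;
  ld_q : vr st 1 = q;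
  ld_r : vr st 2 = r;
  ld_l : vr st 3 = l;
  ld_top : vr st 4 = S + 34;
  ld_low : forall t, t < 35 -> raw st (S + t) = inp t;
  ld_high : forall t, 35 <= t -> t + 5 < S -> raw st (t + 5) = inp t }.

Lemma copy_input_ok st : loaded st ->
  ok V base copy_input st ((p * q + q * r) * 6 + 4)
    (fun st' => forall t, t < p * q + q * r -> ar st' a_in t = inp t).
Proof.
move=> [Ep Eq Er El Et Hlow Hhigh].
rewrite [_ + 4]addnS; apply: ok_set_seq => /=; first by split=> //; lia.
rewrite addnS; apply: ok_set_seq => /=.
  by rewrite Ep Eq Er; do ?split => //; lia.
set st0 := setv _ _ _.
apply: (ok_weaken (@ok_for V base v_x v_n _ st0 (p * q + q * r) (2 + 2)
  (fun x st1 => forall t, t < x -> ar st1 a_in t = inp t) _ _ _ _ _ _)) => //.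
- by rewrite /= Ep Eq Er.
- by lia.
- move=> x st1 Hx [Av _ Er1] Ex HI.
  have Es1 : vr st1 v_s = S by rewrite (Av v_s) //= Et; lia.
  have Er0 : raw st1 = raw st by rewrite Er1.
  have H35 : 35 < V by lia.
  have NR40 : NR = 40 by [].
  have baseE : base = S + 35 by [].
  apply: ok_seq.
  have H1 : ok V base (If (ESub (Cst 35) (Var v_x))
      (Put a_in (Var v_x) (Raw (EAdd (Var v_s) (Var v_x))))) st1 2
      (fun st2 => [/\ vr st2 = vr st1, raw st2 = raw st1 &
         forall t, (t < x) || (t == x) && (x < 35) -> ar st2 a_in t = inp t]).
    apply: ok_if => //= Hlt.
      apply: ok_put => //=; first by rewrite Es1 Ex; do ?split => //; lia.
      split=> // t; rewrite Ex Es1 Er0 orbC.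
      by case: eqP => [-> _|_ /=]; [apply: Hlow; lia | apply: HI].
    split=> // t /orP[|H]; first exact: HI.
    lia.
  apply: (ok_weaken H1) => // st2 _ [Ev2 Er2 H2].
  have E34 : 34 < V by lia.
  apply: ok_if => //=; rewrite Ev2 Ex => Hlt.
    apply: ok_put => //=; first by rewrite Ev2 Ex; do ?split => //; lia.
    move=> t; rewrite ltnS Ev2 Ex Er2 Er0 leq_eqVlt.
    case: eqP => [-> _|_ /= Ht]; first by apply: Hhigh; lia.
    by apply: H2; rewrite Ht.
  move=> t; rewrite ltnS leq_eqVlt => Ht; apply: H2; lia.
- by move=> st' _ [].
Qed.

(* With [q = 0] the budget is only O(p r), which does not pay for [l] rounds;
   a single centre is then already exact. *)
Definition lq : nat := if q == 0 then 1 else l.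

Lemma set_params_ok st (tr : bool) :
  loaded st -> (forall t, t < p * q + q * r -> ar st a_in t = inp t) ->
  forall a b : nat -> nat -> bool,
  (forall i h, i < p -> h < q -> inp (i * q + h) = a i h) ->
  (forall h j, h < q -> j < r -> inp (p * q + h * r + j) = b h j) ->
  ok V base (set_params tr) st 12
    (if tr then env V r q p lq (fun j h => b h j) (fun h i => a i h)
     else env V p q r lq a b).
Proof.
move=> [Ep Eq Er El _ _ _] Hin a b Ha Hb.
have HA i h : i < p -> h < q ->
    ar st a_in (i * q + h) = a i h /\ i * q + h < V.
  move=> Hi Hh; have H : i * q + h < p * q by nia.
  by split; [rewrite Hin ?Ha //; lia | lia].
have HB h j : h < q -> j < r ->
    ar st a_in (p * q + h * r + j) = b h j /\ p * q + h * r + j < V.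
  move=> Hh Hj; have H : h * r + j < q * r by nia.
  by split; [rewrite Hin ?Hb //; lia | lia].
have lq_cond st' : vr st' v_q = q -> vr st' v_l = l ->
    forall Q : state -> Prop, (vr st' v_l = lq -> Q st') ->
    (q = 0 -> Q (setv st' v_l 1)) ->
    ok V base (If (ESub (Cst 1) (Var v_q)) (Set_ v_l (Cst 1))) st' 2 Q.
  move=> Eq' El' Q H1 H2; apply: ok_if => /=; first by split=> //; lia.
    by rewrite Eq' => Hq; apply: ok_set => /=; [lia | apply: H2; lia].
  by rewrite Eq' => Hq; apply: H1; rewrite El' /lq ifF //; lia.
have V1 : 1 < V by lia.
have Hpq : p * q < V by lia.
case: tr; do 10! (apply: ok_set_seq;
  first by rewrite /= ?Ep ?Eq ?Er; do ?split => //; lia).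
  apply: lq_cond => /= [//|//|HL|Hq].
    split=> //= [h i|j h] Hh Hi; rewrite ?Ep ?Eq ?Er ?muln1.
      by rewrite addnAC; apply: HB.
    by rewrite add0n addnC; apply: HA.
  split=> //= [|h i|j h]; rewrite ?Hq //.
  by rewrite /lq Hq.
apply: lq_cond => /= [//|//|HL|Hq].
  split=> //= [i h|h j] Hi Hh; rewrite ?Ep ?Eq ?Er ?muln1.
    by rewrite add0n; apply: HA.
  by apply: HB.
split=> //= [|i h|h j]; rewrite ?Hq //.
by rewrite /lq Hq.
Qed.

Lemma preprocess_ok st (tr : bool) p' r' (a b : nat -> nat -> bool) :
  loaded st ->
  (forall st1, loaded st1 ->
     (forall t, t < p * q + q * r -> ar st1 a_in t = inp t) ->
     ok V base (set_params tr) st1 12 (env V p' q r' lq a b)) ->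
  p' * q + p' * r' + p' + 2 * q + r' + lq + 100 < V ->
  p * q + q * r = p' * q + q * r' -> r' <= p' -> 0 < r' -> 0 < l ->
  ok V base (preprocess tr) st (100 * (p' * q * l + p' * r'))
    (fun st' => exists D cs, [/\ prepared V p' q r' lq a b st' D, D <= q,
       size cs = lq.+1, all (fun u => u < p') cs &
       pairwise (fun u v => D <= hamn q a u v) cs]).
Proof.
move=> Ld Hset V_big' Epq Hrp r_gt0 l_gt0; have p_gt0 : 0 < p' by lia.
have lq_gt0 : 0 < lq by rewrite /lq; case: eqP.
(* For q > 0, r' <= p' bounds everything by multiples of p' q l. For q = 0 there is one round, and
   the cost is linear in p' and r', both at most p' r'. *)
have cost : (p * q + q * r) * 6 + 4 +
    (12 + (lq * (r' * (3 * q + 6) + p' * (3 * q + 12) + 9) + p' * (5 * q + 10) + 7))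
    <= 100 * (p' * q * l + p' * r').
  rewrite Epq /lq; have [q0|q_gt0] := posnP q.
    rewrite q0 ?eqxx !muln0 !mul0n.
    have : p' <= p' * r' by rewrite leq_pmulr.
    have : r' <= p' * r' by rewrite leq_pmull.
    by lia.
  rewrite ?gtn_eqF //.
  have H1 : r' * (3 * q + 6) <= p' * (3 * q + 6) by rewrite leq_mul2r Hrp orbT.
  have H2 : p' * q <= p' * q * l by rewrite leq_pmulr.
  have H3 : p' * l <= p' * q * l by rewrite leq_mul2r leq_pmulr ?orbT.
  have H4 : l <= p' * l by rewrite leq_pmull.
  have H5 : q * r' <= p' * q by rewrite mulnC leq_mul2r Hrp orbT.
  have H6 : p' <= p' * l by rewrite leq_pmulr.
  have H7 : l * (r' * (3 * q + 6)) <= l * (p' * (3 * q + 6)).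
    by rewrite leq_mul2l H1 orbT.
  by lia.
apply: (@ok_weaken V base _ _ _ _ _ _ _ cost) => [|st' _]; last exact.
apply: ok_seq; apply: (ok_weaken (copy_input_ok Ld)) => // st1 [Av _ Er] Hin.
have Ld1 : loaded st1.
  case: Ld => Ep Eq Er' El Et Hlow Hhigh.
  by split; rewrite ?Av ?Er.
apply: ok_seq; apply: (ok_weaken (Hset _ Ld1 Hin)) => // st2 _ E2.
exact: prepare_ok.
Qed.

End Input.

Lemma query_ok V base p q r l a b (tr : bool) st D i j :
  p * q + p * r + p + 2 * q + r + l + 100 < V ->
  prepared V p q r l a b st D ->
  vr st (if tr then 1 else 0) = i -> vr st (if tr then 0 else 1) = j ->
  i < p -> j < r ->
  ok V base (query tr) st (5 * D + 9) (fun st' => vr st' 0 = dotn a b i j q).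
Proof.
move=> V_big [E H1 H2 H3 H4] Ei Ej Hi Hj.
rewrite [_ + 9]addnS; apply: ok_set_seq => //.
rewrite addnS; apply: ok_set_seq => //.
set st1 := setv _ _ _.
have Ei1 : vr st1 v_i = i by rewrite -Ei /st1; case: (tr).
have Ej1 : vr st1 v_j = j by rewrite -Ej /st1; case: (tr).
have P1 : prepared V p q r l a b st1 D.
  by split=> //; do 2! apply: env_setv => //.
have := answer_ok base V_big P1; rewrite Ei1 Ej1; exact.
Qed.

(* The input occupies all cells from 5 on, so the registers have to be vacated
   first: cells 5..NR-1 move to the addresses from [(p + q + r) ^ 8] on, computed
   with cells 4 and 5 only.  Cell 4 is available because exactly one of the two
   parameters l and k is needed; it ends up in cell 3. *)
Definition saves (n : nat) : seq instr :=
  flatten [seq [:: Add 4 4 5; Write 4 x] | x <- iota 6 n].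

Definition prologue (tr : bool) : seq instr :=
  (if tr then [:: Defs.Sub 3 3 3; Add 3 3 4] else [::]) ++
  [:: Add 4 0 1; Add 4 4 2; Mul 4 4 4; Mul 4 4 4; Mul 4 4 4; Write 4 5; Const 5 1]
  ++ saves 34 ++ [:: Add NV 4 5].

(** Cell 4 is the moving write pointer and cell 5 holds its increment. The source cells lie below S,
    hence are still intact when they are copied. *)
Lemma saves_ok V S n m : 256 <= S -> S + n < V -> n <= 34 ->
  (forall x, m x < V) -> m 4 = S -> m 5 = 1 ->
  exists m', [/\ sexec V (saves n) m = Some m', m' 4 = S + n, m' 5 = 1,
    forall t, 0 < t <= n -> m' (S + t) = m (t + 5) &
    forall x : nat, x != 4 -> (x <= S) || (S + n < x) -> m' x = m x].
Proof.
move=> S_big + + Bm E4 E5; elim: n => [|n IH] HV Hn.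
  by exists m; split=> //; [rewrite addn0 | case].
have [||m1 [X1 M4 M5 Ms Mo]] := IH; try lia.
have B1 := sexec_bounded Bm X1.
rewrite /saves -[n.+1]addn1 iotaD map_cat flatten_cat (sexec_cat _ X1) /=.
have F : S + n + 1 < V by lia.
have N4 : (6 + n == 4) = false by lia.
have Em : m1 (6 + n) = m (n + 6) by rewrite addnC Mo //; lia.
have Eu : upd m1 4 (S + n + 1) (6 + n) = m (n + 6) by rewrite /upd N4 Em.
rewrite M4 M5 F Eu Bm.
eexists; split; [reflexivity | | | |]; try by rewrite /= ifF //; lia.
  move=> t Ht /=; case: eqP => [Et|ne]; first by congr m; lia.
  by rewrite ifF ?Ms //; lia.
move=> x Hx4 Hx /=; rewrite (negPf Hx4) ifF; last by lia.
by apply: Mo => //; lia.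
Qed.

(* Bracketed as the machine computes it, by three squarings. *)
Definition pow8 (s : nat) : nat := s * s * (s * s) * (s * s * (s * s)).

Lemma prologue_ok V (tr : bool) m :
  let S := pow8 (m 0 + m 1 + m 2) in
  (forall x, m x < V) -> 256 <= S -> m 0 + m 1 + m 2 < V -> S + 100 < V ->
  exists m', [/\ sexec V (prologue tr) m = Some m',
    [/\ m' 0 = m 0, m' 1 = m 1, m' 2 = m 2 & m' 3 = if tr then m 4 else m 3],
    m' 4 = S + 34, m' NV = S + 35 &
    (forall t, t < 35 -> m' (S + t) = m (t + 5)) /\
    (forall t, 35 <= t -> t + 5 < S -> m' (t + 5) = m (t + 5))].
Proof.
set s := m 0 + m 1 + m 2 => S Bm S_big sV SV.
pose m1 : memory := if tr then upd (upd m 3 0) 3 (m 4) else m.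
have X1 : sexec V (if tr then [:: Defs.Sub 3 3 3; Add 3 3 4] else [::]) m = Some m1.
  rewrite /m1; case: (tr) => //=; rewrite subnn (_ : 0 < V) /=; last by lia.
  by rewrite Bm.
have s1 : s <= s * s by nia.
have s2 : s * s <= s * s * (s * s) by nia.
have s3 : s * s * (s * s) <= S by rewrite /S /pow8 -/s; nia.
have E0 : m1 0 = m 0 by rewrite /m1; case: (tr).
have E1 : m1 1 = m 1 by rewrite /m1; case: (tr).
have E2 : m1 2 = m 2 by rewrite /m1; case: (tr).
have E3 : m1 3 = if tr then m 4 else m 3 by rewrite /m1; case: (tr).
have E5 x : 5 <= x -> m1 x = m x.
  by move=> Hx; rewrite /m1; case: (tr) => //=; rewrite !ifF //; lia.
pose m2 := upd (upd (upd m1 4 S) S (m 5)) 5 1.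
have S5 : (5 == S) = false by lia.
have S4 : (4 == S) = false by lia.
have X2 : sexec V [:: Add 4 0 1; Add 4 4 2; Mul 4 4 4; Mul 4 4 4; Mul 4 4 4;
    Write 4 5; Const 5 1] m1 = Some (upd (upd (upd (upd (upd (upd (upd m1
      4 (m 0 + m 1)) 4 s) 4 (s * s)) 4 (s * s * (s * s))) 4 S) S (m 5)) 5 1).
  rewrite /= E0 E1 (_ : m 0 + m 1 < V) /=; last by rewrite /s in sV; lia.
  rewrite E2 -/s sV /= (_ : s * s < V) /=; last by lia.
  rewrite (_ : s * s * (s * s) < V) /=; last by lia.
  rewrite -/(pow8 s) -/S (_ : S < V) /=; last by lia.
  by rewrite E5 // Bm (_ : 1 < V) //; lia.
set m2' := upd _ 5 1 in X2.
(* The repeated writes to cell 4 leave nested updates; pointwise only the last one counts. *)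
have Em2 x : m2' x = m2 x.
  by rewrite /m2' /m2 /=; case: eqP => // _; case: eqP => // _; case: eqP.
have B2 : forall x, m2' x < V.
  move=> x; rewrite Em2 /m2 /=; do 3! (case: eqP => [_|_]; rewrite ?Bm //; try lia).
  by rewrite /m1; case: (tr) => //=; do 2! (case: eqP => // _; try lia).
have H34 : S + 34 < V by lia.
have M24 : m2' 4 = S by rewrite Em2 /m2 /= S4.
have M25 : m2' 5 = 1 by rewrite Em2.
have [m3 [X3 M4 M5 Ms Mo]] := saves_ok S_big H34 (leqnn 34) B2 M24 M25.
have E35 : S + 35 < V by lia.
exists (upd m3 NV (S + 35)).
(* Cell 5 is saved at S before it receives the increment 1, so the case t = 0 is not covered by
   [saves_ok]. *)
have Ms0 : m3 S = m 5.
  rewrite Mo ?Em2 /m2 /= ?leqnn //; last by lia.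
  by rewrite eqxx ifF //; lia.
have NV28 : NV = 28 by [].
have Mi x : x < S -> x != 4 -> x != 5 -> m3 x = m1 x.
  move=> Hx H4 H5; rewrite Mo //; last by lia.
  by rewrite Em2 /m2 /= (negPf H4) (negPf H5) ifF //; lia.
split.
- rewrite /prologue (sexec_cat _ X1) (sexec_cat _ X2) (sexec_cat _ X3).
  by rewrite /= M4 M5 -addnA E35.
- by split; rewrite /= Mi //; lia.
- by [].
- by [].
split=> t Ht; last first.
  move=> HtS; rewrite /= ifF; last by lia.
  by rewrite Mi ?E5 //; lia.
rewrite /= ifF; last by lia.
case: t Ht => [|t] Ht; first by rewrite addn0.
rewrite Ms // Em2 /m2 /= !ifF; [|lia..].
by rewrite E5 //; lia.
Qed.
(** * Hamming distance *)

Lemma ham_triangle q (x y z : bvec q) : ham x z <= ham x y + ham y z.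
Proof.
apply: leq_trans (leq_card_setU _ _); apply: subset_leq_card; apply/subsetP => h.
rewrite !inE => Hxz; apply: contraNT Hxz.
by rewrite negb_or !negbK => /andP[/eqP -> /eqP ->].
Qed.

Lemma hamC q (x y : bvec q) : ham x y = ham y x.
Proof. by congr #|pred_of_set _|; apply/setP => h; rewrite !inE eq_sym. Qed.

Lemma ham_le q (x y : bvec q) : ham x y <= q.
Proof. by rewrite -{2}(card_ord q); apply: max_card. Qed.

Lemma nearest q (T : {set bvec q}) :
  0 < #|T| -> exists near, forall x, near x \in T /\ ham x (near x) <= dist_to T x.
Proof.
move=> /card_gt0P [u0 Hu0].
exists (fun x => [arg min_(u < u0 in T) ham x u]) => x.
case: arg_minnP => // u Hu Hmin; split=> //.
rewrite /dist_to; elim/big_ind: _ => [|m n Hm Hn|v /Hmin//]; first exact: ham_le.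
by rewrite leq_min Hm.
Qed.

(* Pigeonhole: two of the [l.+1] rows share their nearest point of [T]. *)
Lemma spread_le_lambda p q (A : 'M[bool]_(p, q)) l D (s : seq 'I_p) :
  size s = l.+1 -> D <= q ->
  pairwise (fun i j => D <= ham (row_vec A i) (row_vec A j)) s ->
  D <= 2 * lambda_row A l.
Proof.
move=> Hs Dq Hp; rewrite /lambda_row.
(* The default value q of the minimum is covered by D <= q. *)
elim/big_ind: _ => [|m n Hm Hn|T /andP[T_gt0 T_l]]; first by lia.
  by rewrite /minn; case: ifP.
have [near near_spec] := nearest T_gt0.
have near_in x : near x \in T by case: (near_spec x).
have near_le x : ham x (near x) <= dist_to T x by case: (near_spec x).
pose f i := near (row_vec A i).
have : ~~ uniq (map f s).
  apply/negP => /uniq_leq_size H.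
  have : size (map f s) <= size (enum T).
    apply: H => x /mapP [i _ ->]; rewrite mem_enum; apply: near_in.
  by rewrite size_map Hs -cardE; lia.
case: s Hs Hp => // i0 s Hs Hp.
case/(uniqPn (f i0)) => x [y [xy]]; rewrite size_map => ys.
have xs := ltn_trans xy ys.
rewrite !(nth_map i0) // => E.
have H : D <= ham (row_vec A (nth i0 (i0 :: s) x)) (row_vec A (nth i0 (i0 :: s) y)).
  by move/(pairwiseP i0): Hp; apply.
apply: leq_trans H _; apply: leq_trans (ham_triangle _ (f (nth i0 (i0 :: s) x)) _) _.
rewrite mul2n -addnn; apply: leq_add.
  apply: leq_trans (near_le _) _.
  exact: (leq_bigmax (F := fun i => dist_to T (row_vec A i))).
rewrite E hamC; apply: leq_trans (near_le _) _.
exact: (leq_bigmax (F := fun i => dist_to T (row_vec A i))).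
Qed.

Lemma hamn_ham p q (A : 'M[bool]_(p, q)) (a : nat -> nat -> bool) (i j : 'I_p) :
  (forall (i : 'I_p) (h : 'I_q), a i h = A i h) ->
  hamn q a i j = ham (row_vec A i) (row_vec A j).
Proof.
move=> Ha; rewrite /hamn /diffs /ham -val_enum_ord size_filter count_map.
rewrite cardsE cardE size_filter -enumT; apply: eq_count => h /=.
by rewrite !Ha unfold_in !ffunE.
Qed.

Lemma spread_le_lambda_nat p q (A : 'M[bool]_(p, q)) (a : nat -> nat -> bool)
    l D (s : seq nat) :
  (forall (i : 'I_p) (h : 'I_q), a i h = A i h) ->
  size s = (lq q l).+1 -> D <= q -> all (fun u => u < p) s ->
  pairwise (fun u v => D <= hamn q a u v) s -> D <= 2 * lambda_row A l.
Proof.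
move=> Ha; rewrite /lq; case: eqP => [q0|_] Hs Dq Hp Hf.
  (* Here [s] has only two rows whatever l is, but D <= q = 0. *)
  by move: Dq; rewrite {1}q0 leqn0 => /eqP ->.
have p_gt0 : 0 < p by case: s Hs Hp {Hf} => //= u s _ /andP[]; case: p A Ha.
pose g u := insubd (Ordinal p_gt0) u.
have gE u : u < p -> g u = u :> nat by move=> Hu; rewrite /g val_insubd Hu.
apply: (@spread_le_lambda _ _ _ _ _ (map g s)) => //; first by rewrite size_map.
rewrite pairwise_map.
apply: (sub_in_pairwise (P := fun u => u < p)) Hf => // u v Hu Hv /=.
by rewrite -(hamn_ham _ _ Ha) !gE.
Qed.

Lemma dotn_prod p q r (A : 'M[bool]_(p, q)) (B : 'M[bool]_(q, r))
    (a b : nat -> nat -> bool) (i : 'I_p) (j : 'I_r) :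
  (forall (i : 'I_p) (h : 'I_q), a i h = A i h) ->
  (forall (h : 'I_q) (j : 'I_r), b h j = B h j) ->
  dotn a b i j q = prod_entry A B i j.
Proof.
move=> Ha Hb; rewrite /dotn /prod_entry -{1}(subn0 q) -/(index_iota 0 q) big_mkord.
by apply: eq_bigr => h _; rewrite Ha Hb.
Qed.

Lemma lambda_col_tr q r (B : 'M[bool]_(q, r)) k :
  lambda_col B k = lambda_row B^T%R k.
Proof.
apply: eq_bigr => T _; apply: eq_bigr => j _; congr dist_to.
by apply/ffunP => h; rewrite !ffunE mxE.
Qed.

Lemma prod_entry_tr p q r (A : 'M[bool]_(p, q)) (B : 'M[bool]_(q, r)) i j :
  prod_entry A B i j = prod_entry B^T%R A^T%R j i.
Proof. by apply: eq_bigr => h _; rewrite !mxE mulnC. Qed.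

(** * Reading the matrices off the initial memory *)

Definition bit (m n : nat) (M : 'M[bool]_(m, n)) (i j : nat) : bool :=
  entry M i j != 0.

Lemma bitE m n (M : 'M[bool]_(m, n)) (i : 'I_m) (j : 'I_n) : bit M i j = M i j.
Proof. by rewrite /bit /entry !valK; case: (M i j). Qed.

Lemma entry_bit m n (M : 'M[bool]_(m, n)) i j : entry M i j = bit M i j.
Proof.
by rewrite /bit /entry; case: insubP => // *; case: insubP => // *; case: (M _ _).
Qed.

Section Layout.

Variables (p q r l k : nat) (A : 'M[bool]_(p, q)) (B : 'M[bool]_(q, r)).

Let m := init_mem A B l k.

Lemma init_mem_A i h : i < p -> h < q -> m (i * q + h + 5) = bit A i h.
Proof.
move=> Hi Hh; have H : i * q + h < p * q by nia.
rewrite /m /init_mem.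
do 5! (rewrite ifF; last by lia); rewrite ifT; last by lia.
by rewrite addnK divnMDl ?modnMDl ?divn_small ?modn_small ?addn0 ?entry_bit //; lia.
Qed.

Lemma init_mem_B h j : h < q -> j < r -> m (p * q + h * r + j + 5) = bit B h j.
Proof.
move=> Hh Hj; have H : h * r + j < q * r by nia.
rewrite /m /init_mem.
do 6! (rewrite ifF; last by lia); rewrite ifT; last by lia.
have -> : p * q + h * r + j + 5 - 5 - p * q = h * r + j by lia.
by rewrite divnMDl ?modnMDl ?divn_small ?modn_small ?addn0 ?entry_bit //; lia.
Qed.

Lemma init_mem_lt V : p < V -> q < V -> r < V -> l < V -> k < V -> 1 < V ->
  forall x, m x < V.
Proof.
move=> *; rewrite /m /init_mem.
do 5! case: ifP => // _.
case: ifP => _; first by rewrite entry_bit; case: bit => //; lia.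
case: ifP => _; last by lia.
by rewrite entry_bit; case: bit => //; lia.
Qed.

End Layout.
(** * Assembly *)

(** Since s >= 2, three squarings give S >= 256, beyond both the input and the cells below [NR]; two
    squarings would give only 16 at s = 2. As s + 2 >= 4, the ninth power leaves a factor 4 above S
    for the remaining terms. *)
Lemma pow8_bounds p q r l : 0 < p -> 0 < r -> l <= p + r ->
  let s := p + q + r in let S := pow8 s in let V := (s + 2) ^ 9 in
  [/\ 256 <= S, p * q + q * r + 5 <= S, s < V, S + 100 < V &
      S + p + q + r + l + p * q + p * r + q * r + 300 < V].
Proof.
move=> p_gt0 r_gt0 Hl s S V.
have s_ge2 : 2 <= s by rewrite /s; lia.
have SE : S = s ^ 8 by rewrite /S /pow8 !expnS expn0 muln1 !mulnA.
have S_T : S <= (s + 2) ^ 8 by rewrite SE leq_exp2r // leq_addr.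
have V_S : 4 * S <= V.
  by rewrite /V expnS; apply: leq_mul => //; lia.
have s2 : 2 * s <= s * s by rewrite leq_mul2r s_ge2 orbT.
have s4 : 4 * (s * s) <= s * s * (s * s) by rewrite leq_mul2r; lia.
have s8 : 16 * (s * s * (s * s)) <= S by rewrite /S /pow8 leq_mul2r; lia.
have ss : p * q + p * r + q * r <= s * s by rewrite /s; lia.
have sE : s = p + q + r by [].
by split; lia.
Qed.

(** The factor 8 makes room for [base + NA * V], where [base] is below V and [NA] is 6; three
    further powers of a number at least 2 supply it. *)
Lemma wbound_ge K p q r :
  12 <= K -> 8 * (p + q + r + 2) ^ 9 <= wbound K p q r.
Proof.
move=> HK; rewrite /wbound addn2; move: (p + q + r) => s.
apply: (@leq_trans (s.+2 ^ (3 + 9))); last by rewrite leq_pexp2l.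
by rewrite expnD leq_mul2r -[8]/(2 ^ 3) leq_exp2r // orbT.
Qed.

Definition code (tr : bool) : program :=
  prologue tr ++ ccmd (size (prologue tr)) (preprocess tr).

Definition query_code (tr : bool) : program := ccmd 0 (query tr).

Lemma wfc_preprocess tr : wfc (preprocess tr).
Proof. by case: tr. Qed.

Lemma wfc_query tr : wfc (query tr).
Proof. by case: tr. Qed.

Lemma straight_prologue tr : all straight (prologue tr).
Proof. by case: tr. Qed.

Lemma exec_halt W P n pc m : size P <= pc -> exec W P n.+1 pc m = Some m.
Proof. by move=> H; rewrite /= nth_default. Qed.

(** Posing a query amounts to assigning registers 0 and 1, which are outside [params], so the
    prepared state survives it. *)
Lemma represents_query base st m i j : NR <= base -> represents base st m ->
  represents base (setv (setv st 0 i) 1 j) (query_mem m i j).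
Proof.
have NV28 : NV = 28 by []. have NR40 : NR = 40 by [].
move=> Hb [Rv Rb Ra Rr]; split=> [x Hx||c t Hc|t Ht]; rewrite /query_mem /=.
- by case: eqP => // _; case: eqP => // _; apply: Rv.
- exact: Rb.
- by rewrite !ifF ?Ra //; lia.
- by rewrite !ifF ?Rr //; lia.
Qed.

Lemma prepared_query V p q r l a b st D i j :
  prepared V p q r l a b st D ->
  prepared V p q r l a b (setv (setv st 0 i) 1 j) D.
Proof.
by move=> [E H1 H2 H3 H4]; split=> //; do 2! apply: env_setv => //.
Qed.

(** D and its witnesses [cs] are exported, and queries are timed against any [lam] with D <= 2
    [lam], so that lambda enters only later, on the level of matrices. *)
Lemma machine_ok (tr : bool) K p q r l (m : memory) (a b : nat -> nat -> bool) :
  let p' := if tr then r else p in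
  let r' := if tr then p else r in
  let a' := if tr then fun j h => b h j else a in
  let b' := if tr then fun h i => a i h else b in
  let W := wbound K p q r in
  12 <= K ->
  size (prologue tr) + 1 + 100 * size (ccmd 0 (preprocess tr)) <= K ->
  10 * size (query_code tr) + 1 <= K ->
  0 < p -> 0 < r -> m 0 = p -> m 1 = q -> m 2 = r ->
  (if tr then m 4 else m 3) = l -> 0 < l <= p' -> r' <= p' ->
  (forall x, m x < (p + q + r + 2) ^ 9) ->
  (forall i h, i < p -> h < q -> m (i * q + h + 5) = a i h) ->
  (forall h j, h < q -> j < r -> m (p * q + h * r + j + 5) = b h j) ->
  exists M, exec W (code tr) (K * (p' * q * l + p' * r')) 0 m = Some M /\
    exists D cs, [/\ D <= q, size cs = (lq q l).+1, all (fun u => u < p') cs,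
      pairwise (fun u v => D <= hamn q a' u v) cs &
      forall i j lam, i < p' -> j < r' -> D <= 2 * lam ->
        exists M', exec W (query_code tr) (K * lam.+1) 0
             (query_mem M (if tr then j else i) (if tr then i else j)) = Some M' /\
           M' 0 = dotn a' b' i j q].
Proof.
move=> p' r' a' b' W K12 KP KQ p_gt0 r_gt0 E0 E1 E2 El /andP[l_gt0 l_p] r_p Bm Ha Hb.
have Hlpr : l <= p + r by rewrite /p' in l_p; case: (tr) l_p; lia.
have [S_big pqS sV SV V_big] := pow8_bounds q p_gt0 r_gt0 Hlpr.
have V8 := wbound_ge p q r K12.
have pl := @prologue_ok ((p + q + r + 2) ^ 9) tr m; rewrite E0 E1 E2 in pl.
have [m1 [X1 [M0 M1 M2 M3] M4 Mb [Mlow Mhigh]]] := pl Bm S_big sV SV.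
move: V8 X1 M4 Mb Mlow Mhigh Bm sV SV V_big S_big pqS {pl}; rewrite -/W.
(* From here on only inequalities between the three scales matter, so the powers become
   variables. *)
move: (_ ^ 9) (pow8 _) => V S V8 X1 M4 Mb Mlow Mhigh Bm sV SV V_big S_big pqS.
move: W V8 => {}W V8.
pose base := S + 35.
have V_W : base + NA * V <= W by rewrite /base (_ : NA = 6) //; lia.
have NR_base : NR <= base by rewrite /base (_ : NR = 40) //; lia.
have NA_V : NA < V by rewrite (_ : NA = 6) //; lia.
have VleW : V <= W by lia.
have B1 := sexec_bounded Bm X1.
(* The abstract state is read off the memory, which makes [represents] hold by definition. *)
pose st := St m1 (fun c t => m1 (base + NA * t + c)) m1.
have Rst : represents base st m1 by split.
have Bst : bounded V st by split=> /=.
pose inp t := m (t + 5).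
have Ld : loaded S p q r l inp st.
  by split=> //; rewrite -El.
have Epq : p * q + q * r = p' * q + q * r' by rewrite /p' /r'; case: (tr); lia.
have Hset st1 : loaded S p q r l inp st1 ->
     (forall t, t < p * q + q * r -> ar st1 a_in t = inp t) ->
     ok V base (set_params tr) st1 12 (env V p' q r' (lq q l) a' b').
  move=> Ld1 Hin; have := set_params_ok S_big pqS V_big tr Ld1 Hin Ha Hb.
  by rewrite /p' /r' /a' /b'; case: (tr).
have r'_gt0 : 0 < r' by rewrite /r'; case: (tr).
have lq_le : lq q l <= l + 1 by rewrite /lq; case: ifP => _; lia.
have V_big' : p' * q + p' * r' + p' + 2 * q + r' + lq q l + 100 < V.
  have : q <= p * q by rewrite leq_pmull.
  by rewrite /p' /r'; case: (tr); lia.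
have [k [st1 [Hk R1 [D [cs [HP HD Hcs Hlt Hpw]]]]]] :=
  preprocess_ok S_big pqS V_big Ld Hset V_big' Epq r_p r'_gt0 l_gt0.
have Bst1 := run_bounded R1 Bst.
have [Hc1 Hc2] : code_at (code tr) 0 (prologue tr) /\
    code_at (code tr) (size (prologue tr)) (ccmd (size (prologue tr)) (preprocess tr)).
  exact: code_at_cat.
have G1 := sexec_reaches (straight_prologue tr) Hc1 (sexec_widen VleW X1).
have [k2 [M [Hk2 RM G2]]] :=
  run_sim NR_base NA_V V_W R1 (wfc_preprocess tr) Hc2 Bst Rst.
exists M; split.
  have G := reaches_trans G1 G2.
  apply: (@exec_le _ _ (size (prologue tr) + k2 + 1)); last first.
    rewrite G exec_halt // /code size_cat (size_ccmd _ (preprocess tr)); lia.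
  set X := p' * q * l + p' * r' in Hk *.
  (* Positivity lets [K * X] absorb the prologue and the final [Halt]. *)
  have X_gt0 : 0 < X.
    by rewrite addn_gt0 [0 < p' * r']muln_gt0 r'_gt0 (leq_trans l_gt0 l_p) orbT.
  have : k2 <= size (ccmd 0 (preprocess tr)) * (100 * X).
    by apply: leq_trans Hk2 _; rewrite leq_mul2l Hk orbT.
  have : (size (prologue tr) + 1 + 100 * size (ccmd 0 (preprocess tr))) * X <= K * X.
    by rewrite leq_mul2r KP orbT.
  have : size (prologue tr) + 1 <= (size (prologue tr) + 1) * X by rewrite leq_pmulr.
  move: (size (prologue tr)) (size _) => x y; lia.
exists D, cs; split=> // i j lam Hi Hj Hlam.
have R2 := represents_query (if tr then j else i) (if tr then i else j) NR_base RM.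
have P2 := prepared_query (if tr then j else i) (if tr then i else j) HP.
set st2 := setv _ _ _ in R2 P2.
have B2 : bounded V st2.
  case: Bst1 => Bv Ba Br; split=> // x /=.
  have : i < V by lia. have : j < V by lia.
  by move=> ? ?; case: eqP => _; first (by case: (tr)); case: eqP => _ //; case: (tr).
have Ei2 : vr st2 (if tr then 1 else 0) = i by rewrite /st2 /=; case: (tr).
have Ej2 : vr st2 (if tr then 0 else 1) = j by rewrite /st2 /=; case: (tr).
have [k3 [st3 [Hk3 R3 Q3]]] := query_ok base V_big' P2 Ei2 Ej2 Hi Hj.
have query_at : code_at (query_code tr) 0 (ccmd 0 (query tr)) by move=> x _.
have [k4 [M' [Hk4 [Mv _ _ _] G4]]] :=
  run_sim NR_base NA_V V_W R3 (wfc_query tr) query_at B2 R2.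
exists M'; split; last by rewrite Mv.
apply: (@exec_le _ _ (k4 + 1)); last by rewrite G4 exec_halt.
apply: leq_trans (leq_mul KQ (leqnn lam.+1)); rewrite /query_code.
have : k4 <= size (ccmd 0 (query tr)) * (10 * lam + 9).
  by apply: leq_trans Hk4 _; rewrite leq_mul2l; apply/orP; right; lia.
by move: (size _) => x; lia.
Qed.

Lemma init_mem_small p q r l k (A : 'M[bool]_(p, q)) (B : 'M[bool]_(q, r)) x :
  l <= p + r -> k <= p + r -> init_mem A B l k x < (p + q + r + 2) ^ 9.
Proof.
move=> Hl Hk; have H : p + q + r + 2 <= (p + q + r + 2) ^ 9.
  by rewrite -{1}(expn1 (p + q + r + 2)) leq_pexp2l // addn2.
by apply: init_mem_lt; move: H; move: (_ ^ 9) => V; lia.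
Qed.

(** A single K serves as time factor and as exponent of the word bound; the code sizes depend only
    on [tr], and are abstracted instead of computed. *)
Lemma constant_exists tr : exists K,
  [/\ 12 <= K,
      size (prologue tr) + 1 + 100 * size (ccmd 0 (preprocess tr)) <= K &
      10 * size (query_code tr) + 1 <= K].
Proof.
move: (size (prologue tr)) (size (ccmd 0 (preprocess tr))) (size (query_code tr)).
by move=> x y z; exists (x + 1 + 100 * y + (10 * z + 1) + 12); split; lia.
Qed.
Theorem theorem3 :
  (* case p >= r *)
  (exists (c : nat) (P Q : program),
     forall (p q r : nat) (A : 'M[bool]_(p, q)) (B : 'M[bool]_(q, r)) (l k : nat),
       0 < l <= p -> 0 < k <= r -> r <= p ->
       exists M : memory,
         exec (wbound c p q r) P (c * (p * q * l + p * r)) 0 (init_mem A B l k)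
           = Some M /\
         forall (i : 'I_p) (j : 'I_r), exists M' : memory,
           exec (wbound c p q r) Q (c * (lambda_row A l).+1) 0 (query_mem M i j)
             = Some M' /\ M' 0 = prod_entry A B i j)
  /\
  (* case p <= r *)
  (exists (c : nat) (P Q : program),
     forall (p q r : nat) (A : 'M[bool]_(p, q)) (B : 'M[bool]_(q, r)) (l k : nat),
       0 < l <= p -> 0 < k <= r -> p <= r ->
       exists M : memory,
         exec (wbound c p q r) P (c * (r * q * k + p * r)) 0 (init_mem A B l k)
           = Some M /\
         forall (i : 'I_p) (j : 'I_r), exists M' : memory,
           exec (wbound c p q r) Q (c * (lambda_col B k).+1) 0 (query_mem M i j)
             = Some M' /\ M' 0 = prod_entry A B i j).
Proof.
split.
- have [K [K12 KP KQ]] := constant_exists false.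
  exists K, (code false), (query_code false) => p q r A B l k l_bnd k_bnd rp.
  have [/andP[l_gt0 l_p] /andP[k_gt0 k_r]] := conj l_bnd k_bnd.
  have bA := @bitE _ _ A; have bB := @bitE _ _ B.
  have p_gt0 := leq_trans l_gt0 l_p; have r_gt0 := leq_trans k_gt0 k_r.
  have small x : init_mem A B l k x < (p + q + r + 2) ^ 9.
    by apply: init_mem_small; lia.
  have [M [HM [D [cs [HD Hcs Hlt Hpw HQ]]]]] := @machine_ok false K p q r l
    (init_mem A B l k) (bit A) (bit B) K12 KP KQ p_gt0 r_gt0
    (erefl p) (erefl q) (erefl r) (erefl l) l_bnd rp small
    (@init_mem_A _ _ _ _ _ A B) (@init_mem_B _ _ _ _ _ A B).
  exists M; split=> // i j.
  have HDl := spread_le_lambda_nat bA Hcs HD Hlt Hpw.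
  have [M' [HM' EM']] := HQ i j _ (ltn_ord i) (ltn_ord j) HDl.
  by exists M'; split=> //; rewrite EM' (dotn_prod _ _ bA bB).
- have [K [K12 KP KQ]] := constant_exists true.
  exists K, (code true), (query_code true) => p q r A B l k l_bnd k_bnd pr.
  have [/andP[l_gt0 l_p] /andP[k_gt0 k_r]] := conj l_bnd k_bnd.
  have bA (h : 'I_q) (i : 'I_p) : bit A i h = A^T%R h i by rewrite mxE bitE.
  have bB (j : 'I_r) (h : 'I_q) : bit B h j = B^T%R j h by rewrite mxE bitE.
  have p_gt0 := leq_trans l_gt0 l_p; have r_gt0 := leq_trans k_gt0 k_r.
  have small x : init_mem A B l k x < (p + q + r + 2) ^ 9.
    by apply: init_mem_small; lia.
  have [M [HM [D [cs [HD Hcs Hlt Hpw HQ]]]]] := @machine_ok true K p q r k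
    (init_mem A B l k) (bit A) (bit B) K12 KP KQ p_gt0 r_gt0
    (erefl p) (erefl q) (erefl r) (erefl k) k_bnd pr small
    (@init_mem_A _ _ _ _ _ A B) (@init_mem_B _ _ _ _ _ A B).
  rewrite [p * r]mulnC.
  exists M; split=> // i j.
  have HDl := spread_le_lambda_nat bB Hcs HD Hlt Hpw.
  rewrite lambda_col_tr.
  have [M' [HM' EM']] := HQ j i _ (ltn_ord j) (ltn_ord i) HDl.
  exists M'; split=> //; rewrite EM' prod_entry_tr.
  exact: (dotn_prod _ _ bB bA).
Qed.
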